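(* The dGLsc proof calculus is sound: every dGLsc formula derivable in it is valid (true in every state).
   Context: Semi-competitive differential game logic (dGLsc). States are maps $\omega:\mathcal{V}\to\mathbb{R}$; $\mathcal{S}$ is the set of all states; $\omega_x^r$ agrees with $\omega$ except at $x$ (value $r$); $\omega[\![e]\!]$ is the value of term $e$; $Z^\complement=\mathcal{S}\setminus Z$. Hybrid games: $\alpha,\beta::= x:=e \mid x'=f(x)\,\&\,Q \mid ?Q \mid \alpha\cup\beta \mid \alpha;\beta \mid \alpha^d \mid \alpha^*$. Formulas: $P,Q::= e\ge\tilde e\mid\neg P\mid P\wedge Q\mid\forall x P\mid\exists xP\mid\langle\alpha\rangle(P,Q)\mid[\alpha](P,Q)$, first-order connectives as usual, $[\![\langle\alpha\rangle(P,Q)]\!]=\varsigma_\alpha([\![P]\!],[\![Q]\!])$, $[\![[\alpha](P,Q)]\!]=\delta_\alpha([\![P]\!],[\![Q]\!])$. Write $\varphi\models x'=f(x)\wedge Q$ for a differentiable $\varphi:[0,r]\to\mathcal S$ ($r\ge0$) with $\varphi(s)\in[\![Q]\!]$ and $\frac{d\varphi(t)(x)}{dt}(s)=\varphi(s)[\![f(x)]\!]$ for all $0\le s\le r$. Angel: $\varsigma_{x:=e}(X,Y)=\{\omega\mid\omega_x^{\omega[\![e]\!]}\in X\}$; $\varsigma_{x'=f(x)\&Q}(X,Y)=\{\varphi(0)\mid\varphi(r)\in X$ for some $\varphi\models x'=f(x)\wedge Q\}$; $\varsigma_{?Q}(X,Y)=[\![Q]\!]\cap X$; $\varsigma_{\alpha\cup\beta}=\varsigma_\alpha(X,Y)\cup\varsigma_\beta(X,Y)$;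 $\varsigma_{\alpha;\beta}(X,Y)=\varsigma_\alpha(\varsigma_\beta(X,Y),\delta_\beta(X,Y))$; $\varsigma_{\alpha^d}(X,Y)=\delta_\alpha(Y,X)$; $\varsigma_{\alpha^*}(X,Y)=\bigcap\{Z\mid X\cup\varsigma_\alpha(Z,Z^\complement)\subseteq Z\}\cup\bigcap\{Z\mid (X\cap Y)\cup(\varsigma_\alpha(Z,Z)\cap\delta_\alpha(Z,Z))\subseteq Z\}$. Demon: $\delta_{x:=e}(X,Y)=\{\omega\mid\omega_x^{\omega[\![e]\!]}\in Y\}$; $\delta_{x'=f(x)\&Q}(X,Y)=\{\varphi(0)\mid\varphi(r)\in Y$ for all $\varphi\models x'=f(x)\wedge Q\}\cup\{\varphi(0)\mid\varphi(r)\in X\cap Y$ for some $\varphi\models x'=f(x)\wedge Q\}$; $\delta_{?Q}(X,Y)=[\![Q]\!]^\complement\cup Y$; $\delta_{\alpha\cup\beta}(X,Y)=(\delta_\alpha\cap\delta_\beta)\cup(\delta_\alpha\cap\varsigma_\alpha)\cup(\delta_\beta\cap\varsigma_\beta)$ (all at $(X,Y)$); $\delta_{\alpha;\beta}(X,Y)=\delta_\alpha(\varsigma_\beta(X,Y),\delta_\beta(X,Y))$; $\delta_{\alpha^d}(X,Y)=\varsigma_\alpha(Y,X)$; $\delta_{\alpha^*}(X,Y)=\bigcup\{Z\mid Z\subseteq Y\cap\delta_\alpha(Z^\complement,Z)\}\cup\bigcap\{Z\mid (X\cap Y)\cup(\varsigma_\alpha(Z,Z)\cap\delta_\alpha(Z,Z))\subseteq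 Z\}$. Abbreviations: $\langle\alpha\rangle P:=\langle\alpha\rangle(P,\neg P)$, $[\alpha]Q:=[\alpha](\neg Q,Q)$. The dGLsc proof calculus consists of all proof rules of first-order logic together with the following axioms and rules (in $\langle'\rangle,[']$, $y(t)$ resp. $x(t)$ denotes the solution at time $t$ of $y'=f(y)$ resp. $x'=f(x)$ from the current value of $x$): $\langle:=\rangle$: $\langle x:=e\rangle(p(x),q(x))\leftrightarrow p(e)$; $[:=]$: $[x:=e](p(x),q(x))\leftrightarrow q(e)$; $\langle'\rangle$: $\langle x'=f(x)\rangle(P,Q)\leftrightarrow\exists t{\ge}0\,\langle x:=y(t)\rangle(P,Q)$; $[']$: $[x'=f(x)](P,Q)\leftrightarrow\forall t{\ge}0\,[x:=x(t)](P,Q)\vee\exists t{\ge}0\,\langle x:=x(t)\rangle(P\wedge Q,Q)$; $\langle?\rangle$: $\langle ?R\rangle(P,Q)\leftrightarrow R\wedge P$; $[?]$: $[?R](P,Q)\leftrightarrow\neg R\vee Q$; $\langle\cup\rangle$: $\langle\alpha\cup\beta\rangle(P,Q)\leftrightarrow\langle\alpha\rangle(P,Q)\vee\langle\beta\rangle(P,Q)$; $[\cup]$: $[\alpha\cup\beta](P,Q)\leftrightarrow([\alpha](P,Q)\wedge[\beta](P,Q))\vee([\alpha](P,Q)\wedge\langle\alpha\rangle(P,Q))\vee([\beta](P,Q)\wedge\langle\beta\rangle(P,Q))$; $\langle;\rangle$: $\langle\alpha;\beta\rangle(P,Q)\leftrightarrow\langle\alpha\rangle(\langle\beta\rangle(P,Q),[\beta](P,Q))$;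 $[;]$: $[\alpha;\beta](P,Q)\leftrightarrow[\alpha](\langle\beta\rangle(P,Q),[\beta](P,Q))$; $\langle^d\rangle$: $\langle\alpha^d\rangle(P,Q)\leftrightarrow[\alpha](Q,P)$; $\langle^*\rangle$: $\langle\alpha^*\rangle(P,Q)\leftrightarrow P\vee\langle\alpha;\alpha^*\rangle(P,Q)$; $[^*]$: $[\alpha^*](P,Q)\leftrightarrow(P\wedge Q)\vee(\langle\alpha;\alpha^*\rangle(P,Q)\wedge[\alpha;\alpha^*](P,Q))\vee(Q\wedge[\alpha;\alpha^*]Q)$; FP: from $P\vee\langle\alpha\rangle R_1\to R_1$ and $(P\wedge Q)\vee(\langle\alpha\rangle(R_2,R_2)\wedge[\alpha](R_2,R_2))\to R_2$ infer $\langle\alpha^*\rangle(P,Q)\to R_1\vee R_2$; M: from $P_1\to P_2$ and $Q_1\to Q_2$ infer $\langle\alpha\rangle(P_1,Q_1)\to\langle\alpha\rangle(P_2,Q_2)$; M2: from $P_1\to P_2$ and $P_1\wedge Q_1\to\bot$ infer $\langle\alpha\rangle(P_1,Q_1)\to\langle\alpha\rangle(P_2,Q_2)$; det: $\neg\langle\alpha\rangle P\leftrightarrow[\alpha]\neg P$.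
   Formalization: Solutions φ of x'=f(x)∧Q are also required to keep every variable other than x constant (the usual convention); with the literal definition the axiom ⟨'⟩ is unsound, e.g. for ⟨x'=1⟩(y≥1,Q) at y=0. Terms are taken to be polynomials, and t is fresh in ⟨'⟩ and [']. *)

(* Defs.v *)
(* Written against the Rocq standard library, with its classical reals [R]. *)
From Stdlib Require Import Reals List Bool PeanoNat.
Import ListNotations.
Open Scope R_scope.

(** * Syntax *)

Definition var := nat.

(* Terms are polynomials, as in differential game logic. *)
Inductive term : Type :=
| Var (x : var)
| Const (c : R)
| Add (a b : term)
| Mul (a b : term).

(* [ODE x f Q] is x' = f & Q.  The right-hand side [f] is an arbitrary term: it
   may mention variables other than [x], which act as constant parameters. *)
Inductive fml : Type :=
| Geq (a b : term)
| Not (P : fml)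
| And (P Q : fml)
| All (x : var) (P : fml)
| Ex (x : var) (P : fml)
| Dia (a : game) (P Q : fml)
| Box (a : game) (P Q : fml)
with game : Type :=
| Assign (x : var) (e : term)
| ODE (x : var) (f : term) (Q : fml)
| Test (Q : fml)
| Choice (a b : game)
| Seq (a b : game)
| Dual (a : game)
| Star (a : game).

Definition Or (P Q : fml) : fml := Not (And (Not P) (Not Q)).
Definition Imp (P Q : fml) : fml := Or (Not P) Q.
Definition Iff (P Q : fml) : fml := And (Imp P Q) (Imp Q P).
Definition Top : fml := Geq (Const 0) (Const 0).
Definition Bot : fml := Not Top.
Definition Equal (a b : term) : fml := And (Geq a b) (Geq b a).

Definition AllNonneg (t : var) (P : fml) : fml :=
  All t (Imp (Geq (Var t) (Const 0)) P).
Definition ExNonneg (t : var) (P : fml) : fml :=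
  Ex t (And (Geq (Var t) (Const 0)) P).

(* The zero-sum modalities. *)
Definition Dia1 (a : game) (P : fml) : fml := Dia a P (Not P).
Definition Box1 (a : game) (Q : fml) : fml := Box a (Not Q) Q.

(** * Semantics *)

Definition state := var -> R.
Definition sset := state -> Prop.

Definition upd (w : state) (x : var) (r : R) : state :=
  fun y => if Nat.eqb y x then r else w y.

Definition compl (Z : sset) : sset := fun w => ~ Z w.

Fixpoint eval (w : state) (e : term) : R :=
  match e with
  | Var x => w x
  | Const c => c
  | Add a b => eval w a + eval w b
  | Mul a b => eval w a * eval w b
  end.

(* Only the restriction of [phi] to [0, r] matters: [D_in] is the derivative
   relative to that interval, hence one-sided at its endpoints and no constraint
   at all if r = 0.  Variables other than [x] do not change along the flow. *)
Definition flow (x : var) (f : term) (Q : sset) (r : R) (phi : R -> state)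
  : Prop :=
  0 <= r /\
  forall s, 0 <= s <= r ->
    Q (phi s) /\
    D_in (fun t => phi t x) (fun t => eval (phi t) f) (fun t => 0 <= t <= r) s /\
    (forall y, y <> x -> phi s y = phi 0 y).

Definition lfp (F : sset -> sset) : sset :=
  fun w => forall Z : sset, (forall v, F Z v -> Z v) -> Z w.
Definition gfp (F : sset -> sset) : sset :=
  fun w => exists Z : sset, (forall v, Z v -> F Z v) /\ Z w.

Fixpoint sem (P : fml) : sset :=
  match P with
  | Geq a b => fun w => eval w a >= eval w b
  | Not P => fun w => ~ sem P w
  | And P Q => fun w => sem P w /\ sem Q w
  | All x P => fun w => forall r : R, sem P (upd w x r)
  | Ex x P => fun w => exists r : R, sem P (upd w x r)
  | Dia a P Q => angel a (sem P) (sem Q)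
  | Box a P Q => demon a (sem P) (sem Q)
  end
with angel (a : game) (X Y : sset) {struct a} : sset :=
  match a with
  | Assign x e => fun w => X (upd w x (eval w e))
  | ODE x f Q => fun w =>
      exists r phi, flow x f (sem Q) r phi /\ phi 0 = w /\ X (phi r)
  | Test Q => fun w => sem Q w /\ X w
  | Choice a b => fun w => angel a X Y w \/ angel b X Y w
  | Seq a b => angel a (angel b X Y) (demon b X Y)
  | Dual a => demon a Y X
  | Star a => fun w =>
      lfp (fun Z v => X v \/ angel a Z (compl Z) v) w \/
      lfp (fun Z v => (X v /\ Y v) \/ (angel a Z Z v /\ demon a Z Z v)) w
  end
with demon (a : game) (X Y : sset) {struct a} : sset :=
  match a with
  | Assign x e => fun w => Y (upd w x (eval w e))
  | ODE x f Q => fun w =>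
      (forall r phi, flow x f (sem Q) r phi -> phi 0 = w -> Y (phi r)) \/
      (exists r phi, flow x f (sem Q) r phi /\ phi 0 = w /\
                     X (phi r) /\ Y (phi r))
  | Test Q => fun w => ~ sem Q w \/ Y w
  | Choice a b => fun w =>
      (demon a X Y w /\ demon b X Y w) \/
      (demon a X Y w /\ angel a X Y w) \/
      (demon b X Y w /\ angel b X Y w)
  | Seq a b => demon a (angel b X Y) (demon b X Y)
  | Dual a => angel a Y X
  | Star a => fun w =>
      gfp (fun Z v => Y v /\ demon a (compl Z) Z v) w \/
      lfp (fun Z v => (X v /\ Y v) \/ (angel a Z Z v /\ demon a Z Z v)) w
  end.

Definition valid (P : fml) : Prop := forall w, sem P w.

(** * Free and bound variables *)

Fixpoint tvars (e : term) : list var :=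
  match e with
  | Var x => [x]
  | Const _ => []
  | Add a b | Mul a b => tvars a ++ tvars b
  end.

Definition occurs (x : var) (e : term) : bool := existsb (Nat.eqb x) (tvars e).

(* [x] is written on some play of the game. *)
Fixpoint may_bind (x : var) (a : game) : bool :=
  match a with
  | Assign y _ | ODE y _ _ => Nat.eqb x y
  | Test _ => false
  | Choice a b | Seq a b => may_bind x a || may_bind x b
  | Dual a | Star a => may_bind x a
  end.

(* [x] is written on every completed play of the game. *)
Fixpoint must_bind (x : var) (a : game) : bool :=
  match a with
  | Assign y _ | ODE y _ _ => Nat.eqb x y
  | Test _ | Star _ => false
  | Choice a b => must_bind x a && must_bind x b
  | Seq a b => must_bind x a || must_bind x b
  | Dual a => must_bind x a
  end.

Fixpoint free (x : var) (P : fml) : bool :=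
  match P with
  | Geq a b => occurs x a || occurs x b
  | Not P => free x P
  | And P Q => free x P || free x Q
  | All y P | Ex y P => negb (Nat.eqb x y) && free x P
  | Dia a P Q | Box a P Q =>
      gfree x a || (negb (must_bind x a) && (free x P || free x Q))
  end
with gfree (x : var) (a : game) : bool :=
  match a with
  | Assign _ e => occurs x e
  | ODE y f Q => Nat.eqb x y || occurs x f || free x Q
  | Test Q => free x Q
  | Choice a b => gfree x a || gfree x b
  | Seq a b => gfree x a || (negb (must_bind x a) && gfree x b)
  | Dual a | Star a => gfree x a
  end.

(** * Substitution *)

Fixpoint tsubst (x : var) (e : term) (t : term) : term :=
  match t with
  | Var y => if Nat.eqb y x then e else Var y
  | Const c => Const c
  | Add a b => Add (tsubst x e a) (tsubst x e b)
  | Mul a b => Mul (tsubst x e a) (tsubst x e b)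
  end.

(* What replacing [x] by [e] means behind a binder: [Live] if neither [x] nor a
   variable of [e] can have been written, so replacement proceeds; [Dead] if [x]
   has certainly been overwritten, so there is nothing left to replace; [Clash]
   otherwise, where a free occurrence of [x] makes the substitution undefined. *)
Inductive status := Live | Dead | Clash.

Definition behind_quantifier (x : var) (e : term) (y : var) : status :=
  if Nat.eqb y x then Dead else if occurs y e then Clash else Live.

Definition behind_game (x : var) (e : term) (a : game) : status :=
  if must_bind x a then Dead
  else if existsb (fun y => may_bind y a) (x :: tvars e) then Clash
  else Live.

(* Unlike after an ODE, a write of [x] during it does not make [x] [Dead] in the
   right-hand side and domain, as the initial value of [x] is still read there. *)
Definition inside_ode (x : var) (e : term) (y : var) : status :=
  if Nat.eqb y x || occurs y e then Clash else Live.

Definition guarded {A : Type} (s : status) (is_free : bool) (same : A)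
    (replaced : option A) : option A :=
  match s with
  | Live => replaced
  | Dead => Some same
  | Clash => if is_free then None else Some same
  end.

Definition omap1 {A B : Type} (f : A -> B) (a : option A) : option B :=
  match a with Some a => Some (f a) | None => None end.

Definition omap2 {A B C : Type} (f : A -> B -> C) (a : option A) (b : option B)
  : option C :=
  match a, b with Some a, Some b => Some (f a b) | _, _ => None end.

Definition omap3 {A B C D : Type} (f : A -> B -> C -> D)
    (a : option A) (b : option B) (c : option C) : option D :=
  match a, b, c with
  | Some a, Some b, Some c => Some (f a b c)
  | _, _, _ => None
  end.

(* Capture-avoiding replacement of the free occurrences of [x] by [e], undefined
   if some free occurrence is in the scope of a quantifier or game that may bind
   [x] or a variable of [e].  For a loop, whose body is in its own scope,
   [behind_game] of the loop decides about the body, too. *)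
Fixpoint fsubst (x : var) (e : term) (P : fml) : option fml :=
  match P with
  | Geq a b => Some (Geq (tsubst x e a) (tsubst x e b))
  | Not P => omap1 Not (fsubst x e P)
  | And P Q => omap2 And (fsubst x e P) (fsubst x e Q)
  | All y P =>
      omap1 (All y)
        (guarded (behind_quantifier x e y) (free x P) P (fsubst x e P))
  | Ex y P =>
      omap1 (Ex y)
        (guarded (behind_quantifier x e y) (free x P) P (fsubst x e P))
  | Dia a P Q =>
      omap3 Dia (gsubst x e a)
        (guarded (behind_game x e a) (free x P) P (fsubst x e P))
        (guarded (behind_game x e a) (free x Q) Q (fsubst x e Q))
  | Box a P Q =>
      omap3 Box (gsubst x e a)
        (guarded (behind_game x e a) (free x P) P (fsubst x e P))
        (guarded (behind_game x e a) (free x Q) Q (fsubst x e Q))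
  end
with gsubst (x : var) (e : term) (a : game) : option game :=
  match a with
  | Assign y t => Some (Assign y (tsubst x e t))
  | ODE y f Q =>
      guarded (inside_ode x e y) (gfree x (ODE y f Q)) (ODE y f Q)
        (omap1 (ODE y (tsubst x e f)) (fsubst x e Q))
  | Test Q => omap1 Test (fsubst x e Q)
  | Choice a b => omap2 Choice (gsubst x e a) (gsubst x e b)
  | Seq a b =>
      omap2 Seq (gsubst x e a)
        (guarded (behind_game x e a) (gfree x b) b (gsubst x e b))
  | Dual a => omap1 Dual (gsubst x e a)
  | Star a =>
      omap1 Star
        (guarded (behind_game x e (Star a)) (gfree x a) a (gsubst x e a))
  end.

(* [P'] is p(e) where [P] is p(x).  Replacing [x] by itself is always possible,
   even where [fsubst] is undefined because a game may bind [x]. *)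
Definition instance (x : var) (e : term) (P P' : fml) : Prop :=
  (e = Var x /\ P' = P) \/ fsubst x e P = Some P'.

(** * Proof calculus *)

(* Formulas other than negations and conjunctions are propositional atoms. *)
Fixpoint peval (v : fml -> bool) (P : fml) : bool :=
  match P with
  | Not P => negb (peval v P)
  | And P Q => peval v P && peval v Q
  | _ => v P
  end.

Definition tautology (P : fml) : Prop := forall v, peval v P = true.

(* The term [y], in which the variable [t] stands for time, is the solution
   y(t) of x' = f from the current value of [x], at all times t >= 0. *)
Definition solution (x : var) (f : term) (t : var) (y : term) : Prop :=
  forall w : state,
    eval (upd w t 0) y = w x /\
    forall r, 0 <= r ->
      flow x f (fun _ => True) r (fun s => upd w x (eval (upd w t s) y)).

Definition fresh (t x : var) (f : term) (P Q : fml) : Prop :=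
  t <> x /\ occurs t f = false /\ free t P = false /\ free t Q = false.

(* The first group is a Hilbert calculus for first-order logic with equality. *)
Inductive derivable : fml -> Prop :=
| fol_taut P : tautology P -> derivable P
| fol_mp P Q : derivable (Imp P Q) -> derivable P -> derivable Q
| fol_gen x P : derivable P -> derivable (All x P)
| fol_inst x e P P' : instance x e P P' -> derivable (Imp (All x P) P')
| fol_dist x P Q :
    derivable (Imp (All x (Imp P Q)) (Imp (All x P) (All x Q)))
| fol_vacuous x P : free x P = false -> derivable (Imp P (All x P))
| fol_exists x P : derivable (Iff (Ex x P) (Not (All x (Not P))))
| fol_refl e : derivable (Equal e e)
| fol_leibniz x e1 e2 P P1 P2 :
    instance x e1 P P1 -> instance x e2 P P2 ->
    derivable (Imp (Equal e1 e2) (Imp P1 P2))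

| dia_assign x e P Q P' :
    instance x e P P' -> derivable (Iff (Dia (Assign x e) P Q) P')
| box_assign x e P Q Q' :
    instance x e Q Q' -> derivable (Iff (Box (Assign x e) P Q) Q')
| dia_ode x f t y P Q :
    fresh t x f P Q -> solution x f t y ->
    derivable (Iff (Dia (ODE x f Top) P Q) (ExNonneg t (Dia (Assign x y) P Q)))
| box_ode x f t y P Q :
    fresh t x f P Q -> solution x f t y ->
    derivable (Iff (Box (ODE x f Top) P Q)
                   (Or (AllNonneg t (Box (Assign x y) P Q))
                       (ExNonneg t (Dia (Assign x y) (And P Q) Q))))
| dia_test R P Q : derivable (Iff (Dia (Test R) P Q) (And R P))
| box_test R P Q : derivable (Iff (Box (Test R) P Q) (Or (Not R) Q))
| dia_choice a b P Q :
    derivable (Iff (Dia (Choice a b) P Q) (Or (Dia a P Q) (Dia b P Q)))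
| box_choice a b P Q :
    derivable (Iff (Box (Choice a b) P Q)
                   (Or (Or (And (Box a P Q) (Box b P Q))
                           (And (Box a P Q) (Dia a P Q)))
                       (And (Box b P Q) (Dia b P Q))))
| dia_seq a b P Q :
    derivable (Iff (Dia (Seq a b) P Q) (Dia a (Dia b P Q) (Box b P Q)))
| box_seq a b P Q :
    derivable (Iff (Box (Seq a b) P Q) (Box a (Dia b P Q) (Box b P Q)))
| dia_dual a P Q : derivable (Iff (Dia (Dual a) P Q) (Box a Q P))
| dia_star a P Q :
    derivable (Iff (Dia (Star a) P Q) (Or P (Dia (Seq a (Star a)) P Q)))
| box_star a P Q :
    derivable (Iff (Box (Star a) P Q)
                   (Or (Or (And P Q)
                           (And (Dia (Seq a (Star a)) P Q)
                                (Box (Seq a (Star a)) P Q)))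
                       (And Q (Box1 (Seq a (Star a)) Q))))
| rule_FP a P Q R1 R2 :
    derivable (Imp (Or P (Dia1 a R1)) R1) ->
    derivable (Imp (Or (And P Q) (And (Dia a R2 R2) (Box a R2 R2))) R2) ->
    derivable (Imp (Dia (Star a) P Q) (Or R1 R2))
| rule_M a P1 P2 Q1 Q2 :
    derivable (Imp P1 P2) -> derivable (Imp Q1 Q2) ->
    derivable (Imp (Dia a P1 Q1) (Dia a P2 Q2))
| rule_M2 a P1 P2 Q1 Q2 :
    derivable (Imp P1 P2) -> derivable (Imp (And P1 Q1) Bot) ->
    derivable (Imp (Dia a P1 Q1) (Dia a P2 Q2))
| axiom_det a P : derivable (Iff (Not (Dia1 a P)) (Box1 a (Not P))).

(* Main.v *)
(* Everything rests on one semantic fact: if Angel and Demon can both win, then they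
   also agree on a play that both of them win, so
   [angel a X Y] and [demon a X Y] intersect inside [coop a (inter X Y)].  Together with
   determinacy of the zero-sum case, it yields the unfoldings of loops: where Angel
   cannot win [a*] on her own, Demon can avoid her winning region, and a joint play of
   this strategy and an Angel strategy of [a; a*] ends in the cooperative fixpoint.
   The first-order and assignment axioms reduce to coincidence and substitution lemmas,
   and the differential equation axioms to uniqueness of solutions, by Gronwall. *)
From Stdlib Require Import Reals Lra List Bool PeanoNat.
From Stdlib Require Import Classical ClassicalEpsilon FunctionalExtensionality PropExtensionality.
From Coquelicot Require Import Coquelicot.
Require Import Defs.
Open Scope R_scope.

(** * Monotonicity and determinacy of games *)

Definition incl (X Y : sset) : Prop := forall w, X w -> Y w.
Definition disjoint (X Y : sset) : Prop := forall w, X w -> ~ Y w.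
Definition inter (X Y : sset) : sset := fun w => X w /\ Y w.
Definition union (X Y : sset) : sset := fun w => X w \/ Y w.

Lemma sset_ext (X Y : sset) : (forall w, X w <-> Y w) -> X = Y.
Proof.
  intros H; apply functional_extensionality; intros w.
  apply propositional_extensionality, H.
Qed.

Lemma lfp_mono (F G : sset -> sset) :
  (forall Z, incl (F Z) (G Z)) -> incl (lfp F) (lfp G).
Proof. intros H w Hw Z HZ; apply Hw; intros v Hv; apply HZ, H, Hv. Qed.

Lemma gfp_mono (F G : sset -> sset) :
  (forall Z, incl (F Z) (G Z)) -> incl (gfp F) (gfp G).
Proof.
  intros H w (Z & HZ & Hw); exists Z; split; [intros v Hv; apply H, HZ, Hv | exact Hw].
Qed.

Definition monotone (F : sset -> sset) : Prop :=
  forall Z Z', incl Z Z' -> incl (F Z) (F Z').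

Lemma lfp_fold F : monotone F -> incl (F (lfp F)) (lfp F).
Proof.
  intros HF w Hw Z HZ; apply HZ; revert Hw; apply HF.
  intros v Hv; apply Hv, HZ.
Qed.

Lemma lfp_unfold F : monotone F -> incl (lfp F) (F (lfp F)).
Proof.
  intros HF w Hw; apply Hw; intros v; apply HF, lfp_fold, HF.
Qed.

Lemma gfp_unfold F : monotone F -> incl (gfp F) (F (gfp F)).
Proof.
  intros HF w (Z & HZ & Hw); apply HZ in Hw; revert Hw; apply HF.
  intros v Hv; exists Z; auto.
Qed.

Lemma gfp_fold F : monotone F -> incl (F (gfp F)) (gfp F).
Proof.
  intros HF w Hw; exists (F (gfp F)); split; [|exact Hw].
  intros v; apply HF, gfp_unfold, HF.
Qed.

Lemma game_mono a X Y X' Y' : incl X X' -> incl Y Y' ->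
  incl (angel a X Y) (angel a X' Y') /\ incl (demon a X Y) (demon a X' Y').
Proof.
  revert X Y X' Y'.
  induction a as [x e|x f Q|Q|a IHa b IHb|a IHa b IHb|a IHa|a IHa];
    intros X Y X' Y' HX HY; simpl.
  - split; intros w; simpl; auto.
  - split; intros w; simpl.
    + intros (r & phi & H & H0 & Hr); exists r, phi; auto.
    + intros [H|(r & phi & H & H0 & Hr & Hr')].
      * left; eauto.
      * right; exists r, phi; auto.
  - split; intros w; simpl; intuition.
  - destruct (IHa _ _ _ _ HX HY), (IHb _ _ _ _ HX HY).
    split; intros w; intuition.
  - apply IHa; apply IHb; assumption.
  - apply and_comm, IHa; assumption.
  - split; intros w [H|H].
    + left; revert H; apply lfp_mono; intros Z v; intuition.
    + right; revert H; apply lfp_mono; intros Z v; intuition.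
    + left; revert H; apply gfp_mono; intros Z v; intuition.
    + right; revert H; apply lfp_mono; intros Z v; intuition.
Qed.

Lemma angel_mono a X Y X' Y' :
  incl X X' -> incl Y Y' -> incl (angel a X Y) (angel a X' Y').
Proof. intros HX HY; apply (game_mono a X Y X' Y' HX HY). Qed.

Lemma demon_mono a X Y X' Y' :
  incl X X' -> incl Y Y' -> incl (demon a X Y) (demon a X' Y').
Proof. intros HX HY; apply (game_mono a X Y X' Y' HX HY). Qed.

Definition coop (a : game) (Z : sset) : sset := inter (angel a Z Z) (demon a Z Z).

Lemma coop_mono a : monotone (coop a).
Proof.
  intros Z Z' H w [Hs Hd].
  split; [revert Hs; apply (angel_mono a) | revert Hd; apply (demon_mono a)]; exact H.
Qed.

Definition reach (a : game) (X : sset) : sset :=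
  lfp (fun Z v => X v \/ angel a Z (compl Z) v).
Definition stay (a : game) (Y : sset) : sset :=
  gfp (fun Z v => Y v /\ demon a (compl Z) Z v).
Definition meet (a : game) (X Y : sset) : sset :=
  lfp (fun Z v => (X v /\ Y v) \/ (angel a Z Z v /\ demon a Z Z v)).

Lemma angel_star a X Y : angel (Star a) X Y = union (reach a X) (meet a X Y).
Proof. reflexivity. Qed.

Lemma demon_star a X Y : demon (Star a) X Y = union (stay a Y) (meet a X Y).
Proof. reflexivity. Qed.

Lemma meet_step_mono a X Y :
  monotone (fun Z v => (X v /\ Y v) \/ (angel a Z Z v /\ demon a Z Z v)).
Proof. intros Z Z' H w [Hw|Hw]; [left | right; revert Hw; apply coop_mono]; auto. Qed.

Lemma meet_fold a X Y w : (X w /\ Y w) \/ coop a (meet a X Y) w -> meet a X Y w.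
Proof. apply (lfp_fold _ (meet_step_mono a X Y)). Qed.

Lemma meet_unfold a X Y w : meet a X Y w -> (X w /\ Y w) \/ coop a (meet a X Y) w.
Proof. apply (lfp_unfold _ (meet_step_mono a X Y)). Qed.

Lemma game_disjoint a X Y :
  disjoint X Y -> disjoint (angel a X Y) (demon a X Y).
Proof.
  revert X Y.
  induction a as [x e|x f Q|Q|a IHa b IHb|a IHa b IHb|a IHa|a IHa];
    intros X Y HXY.
  - intros w; apply HXY.
  - intros w (r & phi & H & H0 & Hr) [Hd|(r' & phi' & H' & H0' & Hr' & Hr'')];
      eapply HXY; eauto.
  - intros w [Hq Hx] [H|H]; [tauto | apply (HXY w); assumption].
  - specialize (IHa X Y HXY); specialize (IHb X Y HXY).
    intros w Hs Hd; specialize (IHa w); specialize (IHb w); simpl in *; tauto.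
  - apply IHa, IHb, HXY.
  - intros w Hs Hd; apply (IHa Y X) with w; [|exact Hd|exact Hs].
    intros v Hy Hx; apply (HXY v); assumption.
  - assert (Hmeet : forall w, ~ meet a X Y w).
    { intros w Hw; apply (Hw (fun _ => False)).
      intros v [[Hx Hy]|[Hs Hd]]; [apply (HXY v); assumption|].
      apply (IHa (fun _ => False) (fun _ => False)) with v; [|exact Hs|exact Hd].
      intros u Hu _; exact Hu. }
    intros w [Hs|Hs] [Hd|Hd]; try (eapply Hmeet; eassumption).
    destruct Hd as (Z & HZ & Hw).
    cut (compl Z w); [intros H; apply H, Hw|].
    apply Hs; intros v [Hx|Ha] Hv; apply HZ in Hv as [Hy Hd].
    + apply (HXY v); assumption.
    + assert (Ha' : angel a (compl Z) Z v).
      { revert Ha; apply (angel_mono a); intros u; [auto | apply NNPP]. }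
      revert Hd; apply (IHa (compl Z) Z); [|exact Ha'].
      intros u Hu Hu'; apply Hu, Hu'.
Qed.

Lemma meet_disjoint a X Y w : disjoint X Y -> ~ meet a X Y w.
Proof.
  intros HXY Hw.
  apply (game_disjoint (Star a) X Y HXY w); [right | right]; exact Hw.
Qed.

(* In a zero-sum situation only the winner's goal matters. *)
Lemma game_zero_sum_mono a X Y X' Y' : disjoint X Y ->
  (incl X X' -> incl (angel a X Y) (angel a X' Y')) /\
  (incl Y Y' -> incl (demon a X Y) (demon a X' Y')).
Proof.
  revert X Y X' Y'.
  induction a as [x e|x f Q|Q|a IHa b IHb|a IHa b IHb|a IHa|a IHa];
    intros X Y X' Y' HXY.
  - split; intros H w; apply H.
  - split; intros H w.
    + intros (r & phi & Hf & H0 & Hr); exists r, phi; auto.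
    + intros [Hd|(r & phi & Hf & H0 & Hr & Hr')].
      * left; intros; apply H; eauto.
      * exfalso; apply (HXY _ Hr Hr').
  - split; intros H w; simpl; intuition.
  - destruct (IHa X Y X' Y' HXY) as [Ha Ha'], (IHb X Y X' Y' HXY) as [Hb Hb'].
    split; intros H w; [specialize (Ha H w); specialize (Hb H w); simpl; tauto|].
    specialize (Ha' H w); specialize (Hb' H w); simpl.
    pose proof (game_disjoint a X Y HXY w); pose proof (game_disjoint b X Y HXY w).
    tauto.
  - split; intros H; apply IHa; try (apply game_disjoint, HXY);
      apply IHb; assumption.
  - apply and_comm, IHa; intros w Hy Hx; apply (HXY w); assumption.
  - split; intros H w [Hw|Hw]; try (destruct (meet_disjoint a X Y w HXY Hw)).
    + left; revert Hw; apply lfp_mono; intros Z v; specialize (H v); tauto.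
    + left; revert Hw; apply gfp_mono; intros Z v; specialize (H v); tauto.
Qed.

Lemma angel_zero_sum_mono a X Y X' Y' :
  disjoint X Y -> incl X X' -> incl (angel a X Y) (angel a X' Y').
Proof. intros H; apply (game_zero_sum_mono a X Y X' Y' H). Qed.

Lemma demon_zero_sum_mono a X Y X' Y' :
  disjoint X Y -> incl Y Y' -> incl (demon a X Y) (demon a X' Y').
Proof. intros H; apply (game_zero_sum_mono a X Y X' Y' H). Qed.

Lemma disjoint_compl X : disjoint X (compl X).
Proof. intros w H H'; apply H', H. Qed.

Lemma compl_disjoint X : disjoint (compl X) X.
Proof. intros w H H'; apply H, H'. Qed.

Lemma reach_step_mono a X :
  monotone (fun Z v => X v \/ angel a Z (compl Z) v).
Proof.
  intros Z Z' H w [Hw|Hw]; [left; exact Hw | right; revert Hw].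
  apply angel_zero_sum_mono; [apply disjoint_compl | exact H].
Qed.

Lemma stay_step_mono a Y :
  monotone (fun Z v => Y v /\ demon a (compl Z) Z v).
Proof.
  intros Z Z' H w [Hy Hw]; split; [exact Hy | revert Hw].
  apply demon_zero_sum_mono; [apply compl_disjoint | exact H].
Qed.

Lemma reach_fold a X w :
  X w \/ angel a (reach a X) (compl (reach a X)) w -> reach a X w.
Proof. apply (lfp_fold _ (reach_step_mono a X)). Qed.

Lemma reach_unfold a X w :
  reach a X w -> X w \/ angel a (reach a X) (compl (reach a X)) w.
Proof. apply (lfp_unfold _ (reach_step_mono a X)). Qed.

Lemma stay_fold a Y w :
  Y w /\ demon a (compl (stay a Y)) (stay a Y) w -> stay a Y w.
Proof. apply (gfp_fold _ (stay_step_mono a Y)). Qed.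

Lemma stay_unfold a Y w :
  stay a Y w -> Y w /\ demon a (compl (stay a Y)) (stay a Y) w.
Proof. apply (gfp_unfold _ (stay_step_mono a Y)). Qed.

Lemma game_cover a X Y : (forall w, X w \/ Y w) ->
  forall w, angel a X Y w \/ demon a X Y w.
Proof.
  revert X Y.
  induction a as [x e|x f Q|Q|a IHa b IHb|a IHa b IHb|a IHa|a IHa];
    intros X Y HXY w.
  - apply HXY.
  - destruct (classic (angel (ODE x f Q) X Y w)) as [H|H]; [left; exact H|].
    right; left; intros r phi Hf H0.
    destruct (HXY (phi r)) as [Hx|Hy]; [|exact Hy].
    destruct H; exists r, phi; auto.
  - destruct (HXY w), (classic (sem Q w)); simpl; tauto.
  - destruct (IHa X Y HXY w), (IHb X Y HXY w); simpl; tauto.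
  - apply IHa; intros v; apply IHb, HXY.
  - apply or_comm, IHa; intros v; apply or_comm, HXY.
  - destruct (classic (reach a X w)) as [H|H]; [left; left; exact H|].
    right; left; exists (compl (reach a X)); split; [|exact H].
    intros v Hv; split.
    + destruct (HXY v) as [Hx|Hy]; [|exact Hy].
      destruct Hv; apply reach_fold; left; exact Hx.
    + destruct (IHa (reach a X) (compl (reach a X))) with (w := v) as [Hs|Hd].
      * intros u; apply classic.
      * destruct Hv; apply reach_fold; right; exact Hs.
      * revert Hd; apply (demon_mono a); intros u Hu; [|exact Hu].
        intros Hu'; apply Hu', Hu.
Qed.

Lemma demon_of_not_angel a X w :
  ~ angel a X (compl X) w -> demon a X (compl X) w.
Proof.
  intros H; destruct (game_cover a X (compl X)) with (w := w) as [Hs|Hd];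
    [intros v; apply classic | contradiction | exact Hd].
Qed.

Lemma angel_demon_star_of_coop a X Y :
  (forall X Y, incl (inter (angel a X Y) (demon a X Y)) (coop a (inter X Y))) ->
  incl (inter (angel (Star a) X Y) (demon (Star a) X Y)) (meet a X Y).
Proof.
  intros IHa w [[Hs|Hs] [Hd|Hd]]; try assumption.
  set (W := union (compl (stay a Y)) (meet a X Y)).
  cut (W w); [intros [H|H]; [contradiction | exact H]|].
  apply Hs; clear w Hs Hd; intros v Hv.
  destruct (classic (stay a Y v)) as [Hd|Hd]; [right | left; exact Hd].
  destruct (stay_unfold _ _ _ Hd) as [Hy Hdv].
  apply meet_fold; destruct Hv as [Hx|Hs]; [left; auto | right].
  apply (coop_mono a (inter W (stay a Y)));
    [intros u [[Hu|Hu] Hu']; [contradiction | exact Hu]|].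
  apply IHa; split.
  - revert Hs; apply angel_zero_sum_mono; [apply disjoint_compl|].
    intros u Hu; exact Hu.
  - revert Hdv; apply demon_zero_sum_mono; [apply compl_disjoint|].
    intros u Hu; exact Hu.
Qed.

Lemma game_coop a X Y :
  incl (inter (angel a X Y) (demon a X Y)) (coop a (inter X Y)).
Proof.
  revert X Y.
  induction a as [x e|x f Q|Q|a IHa b IHb|a IHa b IHb|a IHa|a IHa];
    intros X Y w [Hs Hd].
  - split; split; assumption.
  - assert (H : exists r phi, flow x f (sem Q) r phi /\ phi 0 = w /\
                              inter X Y (phi r)).
    { destruct Hd as [Hd|(r & phi & Hf & H0 & Hr & Hr')].
      - destruct Hs as (r & phi & Hf & H0 & Hr).
        exists r, phi; unfold inter; auto.
      - exists r, phi; unfold inter; auto. }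
    destruct H as (r & phi & Hf & H0 & Hr).
    split; [|right]; exists r, phi; auto.
  - destruct Hs as [Hq Hx], Hd as [Hd|Hy]; [contradiction|].
    split; [split; [exact Hq|] | right]; split; assumption.
  - specialize (IHa X Y w); specialize (IHb X Y w).
    unfold coop, inter in *; simpl in *; tauto.
  - assert (H : coop a (coop b (inter X Y)) w).
    { apply (coop_mono a (inter (angel b X Y) (demon b X Y))); [apply IHb|].
      apply IHa; split; assumption. }
    destruct H as [H H'].
    split; [revert H; apply (angel_mono a) | revert H'; apply (demon_mono a)];
      intros v Hv; apply Hv.
  - assert (H : coop a (inter Y X) w) by (apply IHa; split; assumption).
    apply (coop_mono a _ (inter X Y)) in H; [|intros v [? ?]; split; assumption].
    split; apply H.
  - assert (H : meet a X Y w) by (apply angel_demon_star_of_coop; [exact IHa | split; assumption]).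
    assert (H' : meet a (inter X Y) (inter X Y) w).
    { revert H; apply lfp_mono; intros Z v; unfold inter; tauto. }
    split; right; exact H'.
Qed.

Lemma angel_demon_star a X Y w :
  angel (Star a) X Y w -> demon (Star a) X Y w -> meet a X Y w.
Proof. intros Hs Hd; apply angel_demon_star_of_coop; [apply game_coop | split; assumption]. Qed.

Lemma angel_star_iff a X Y w :
  angel (Star a) X Y w <-> X w \/ angel (Seq a (Star a)) X Y w.
Proof.
  change (angel (Seq a (Star a)) X Y)
    with (angel a (angel (Star a) X Y) (demon (Star a) X Y)).
  split.
  - intros [H|H].
    + apply reach_unfold in H as [H|H]; [left; exact H | right; revert H].
      apply angel_zero_sum_mono; [apply disjoint_compl|]; intros v; left; assumption.
    + apply meet_unfold in H as [[H _]|[H _]]; [left; exact H | right; revert H].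
      apply (angel_mono a); intros v; right; assumption.
  - intros [H|H]; [left; apply reach_fold; left; exact H|].
    destruct (classic (reach a X w)) as [Hr|Hr]; [left; exact Hr | right].
    apply meet_fold; right.
    assert (Hd : demon a (reach a X) (compl (reach a X)) w).
    { apply demon_of_not_angel; intros Ha; apply Hr, reach_fold; right; exact Ha. }
    set (V := union (compl (reach a X)) (demon (Star a) X Y)).
    apply (coop_mono a (inter (angel (Star a) X Y) V)).
    + intros v [Hs [Hv|Hv]]; [|apply angel_demon_star; assumption].
      destruct Hs as [Hs|Hs]; [contradiction | exact Hs].
    + apply game_coop; split.
      * revert H; apply (angel_mono a); [intros v Hv; exact Hv | intros v; right; assumption].
      * revert Hd; apply demon_zero_sum_mono; [apply disjoint_compl | intros v; left; assumption].
Qed.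

Lemma stay_iff a Y w :
  stay a Y w <-> Y w /\ demon (Seq a (Star a)) (compl Y) Y w.
Proof.
  change (demon (Seq a (Star a)) (compl Y) Y)
    with (demon a (angel (Star a) (compl Y) Y) (demon (Star a) (compl Y) Y)).
  split.
  - intros H; apply stay_unfold in H as [Hy H]; split; [exact Hy | revert H].
    apply demon_zero_sum_mono; [apply compl_disjoint | intros v; left; assumption].
  - intros [Hy H]; apply stay_fold; split; [exact Hy | revert H].
    apply demon_zero_sum_mono; [apply game_disjoint, compl_disjoint|].
    intros v [Hv|Hv]; [exact Hv|].
    destruct (meet_disjoint a _ _ v (compl_disjoint Y) Hv).
Qed.

Lemma demon_star_iff a X Y w :
  demon (Star a) X Y w <->
  (X w /\ Y w) \/ (angel (Seq a (Star a)) X Y w /\ demon (Seq a (Star a)) X Y w) \/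
  (Y w /\ demon (Seq a (Star a)) (compl Y) Y w).
Proof.
  rewrite <- stay_iff; split.
  - intros [H|H]; [right; right; exact H|].
    apply meet_unfold in H as [H|[Hs Hd]]; [left; exact H | right; left].
    split; [revert Hs; apply (angel_mono a) | revert Hd; apply (demon_mono a)];
      intros v; right; assumption.
  - intros [H|[H|H]]; [right; apply meet_fold; left; exact H | | left; exact H].
    right; apply meet_fold; right.
    apply (game_coop a (angel (Star a) X Y) (demon (Star a) X Y)) in H.
    revert H; apply coop_mono.
    intros v [Hs Hd]; apply angel_demon_star; assumption.
Qed.

(** * Coincidence *)

Definition agree (x : var) (w v : state) : Prop := forall y, y <> x -> w y = v y.
Definition insens (x : var) (X : sset) : Prop := forall w v, agree x w v -> X w -> X v.

Lemma agree_sym x w v : agree x w v -> agree x v w.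
Proof. intros H y Hy; symmetry; apply H, Hy. Qed.

Lemma agree_trans x w v u : agree x w v -> agree x v u -> agree x w u.
Proof. intros H H' y Hy; rewrite H, H' by exact Hy; reflexivity. Qed.

Lemma upd_same w x r : upd w x r x = r.
Proof. unfold upd; now rewrite Nat.eqb_refl. Qed.

Lemma upd_other w x r y : y <> x -> upd w x r y = w y.
Proof. intros H; unfold upd; apply Nat.eqb_neq in H; now rewrite H. Qed.

Lemma upd_agree w x r : agree x w (upd w x r).
Proof. intros y Hy; now rewrite upd_other. Qed.

Lemma agree_upd_same x w v r : agree x w v -> upd w x r = upd v x r.
Proof.
  intros H; apply functional_extensionality; intros y.
  destruct (Nat.eq_dec y x) as [->|Hy]; [now rewrite !upd_same|].
  rewrite !upd_other by exact Hy; apply H, Hy.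
Qed.

Lemma agree_upd x w v y r : agree x w v -> agree x (upd w y r) (upd v y r).
Proof.
  intros H z Hz; destruct (Nat.eq_dec z y) as [->|Hy]; [now rewrite !upd_same|].
  rewrite !upd_other by exact Hy; apply H, Hz.
Qed.

Lemma upd_id w x : upd w x (w x) = w.
Proof.
  apply functional_extensionality; intros y.
  destruct (Nat.eq_dec y x) as [->|Hy]; [apply upd_same | now apply upd_other].
Qed.

Lemma upd_upd w x r s : upd (upd w x r) x s = upd w x s.
Proof. apply agree_upd_same, agree_sym, upd_agree. Qed.

Lemma upd_comm w x y r s : x <> y -> upd (upd w x r) y s = upd (upd w y s) x r.
Proof.
  intros H; apply functional_extensionality; intros z; unfold upd.
  destruct (Nat.eqb_spec z y), (Nat.eqb_spec z x); congruence.
Qed.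

Lemma agree_upd_eq x w v : agree x w v -> v = upd w x (v x).
Proof. intros H; rewrite (agree_upd_same x w v _ H); symmetry; apply upd_id. Qed.

Lemma insens_compl x X : insens x X -> insens x (compl X).
Proof. intros H w v Hwv Hw Hv; apply Hw; revert Hv; apply H, agree_sym, Hwv. Qed.

Lemma insens_iff x X w v : insens x X -> agree x w v -> (X w <-> X v).
Proof. intros H Hwv; split; apply H; [exact Hwv | apply agree_sym, Hwv]. Qed.

Lemma occurs_app x l1 l2 :
  existsb (Nat.eqb x) (l1 ++ l2) = false ->
  existsb (Nat.eqb x) l1 = false /\ existsb (Nat.eqb x) l2 = false.
Proof. rewrite existsb_app; apply orb_false_iff. Qed.

Lemma eval_agree x e w v : occurs x e = false -> agree x w v -> eval w e = eval v e.
Proof.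
  unfold occurs; intros He H.
  induction e as [y|c|a IHa b IHb|a IHa b IHb]; simpl in *.
  - rewrite orb_false_r in He; apply Nat.eqb_neq in He; apply H; congruence.
  - reflexivity.
  - apply occurs_app in He as [? ?]; rewrite IHa, IHb; auto.
  - apply occurs_app in He as [? ?]; rewrite IHa, IHb; auto.
Qed.

Lemma lfp_insens x F : monotone F ->
  (forall Z, insens x Z -> insens x (F Z)) -> insens x (lfp F).
Proof.
  intros HF H w v Hwv Hw.
  set (K := fun u => forall u', agree x u u' -> lfp F u').
  assert (HK : K w); [|apply HK, Hwv].
  apply Hw; intros u Hu u' Huu'.
  apply lfp_fold; [exact HF|].
  apply (HF K); [intros z Hz; apply Hz; intros y _; reflexivity|].
  revert Hu; apply H; [|exact Huu'].
  intros z z' Hz HKz z'' Hz'; apply HKz; eapply agree_trans; eassumption.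
Qed.

Lemma gfp_insens x F : monotone F ->
  (forall Z, insens x Z -> insens x (F Z)) -> insens x (gfp F).
Proof.
  intros HF H w v Hwv Hw.
  exists (fun u => exists u', agree x u' u /\ gfp F u').
  split; [|exists w; split; assumption].
  intros u (u' & Hu & Hu').
  apply (H (fun u => exists u', agree x u' u /\ gfp F u')) with u'; [|exact Hu|].
  - intros z z' Hz (z'' & Hz' & Hg); exists z''; split; [|exact Hg].
    eapply agree_trans; eassumption.
  - apply gfp_unfold in Hu'; [|exact HF]; revert Hu'; apply HF.
    intros z Hz; exists z; split; [intros y _; reflexivity | exact Hz].
Qed.

Lemma D_in_ext (f g d d' : R -> R) (D : R -> Prop) s :
  (forall t, D t -> g t = f t) -> d' s = d s -> D s ->
  D_in f d D s -> D_in g d' D s.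
Proof.
  intros Hfg Hd HD H eps Heps; destruct (H eps Heps) as (alp & Halp & H').
  exists alp; split; [exact Halp|]; intros t Ht; rewrite Hd, !Hfg; [|assumption|apply Ht].
  apply H', Ht.
Qed.

Lemma flow_transport x f Q f' Q' r phi psi :
  flow x f Q r phi ->
  (forall s, 0 <= s <= r ->
     psi s x = phi s x /\ eval (psi s) f' = eval (phi s) f /\
     (Q (phi s) -> Q' (psi s)) /\ (forall y, y <> x -> psi s y = psi 0 y)) ->
  flow x f' Q' r psi.
Proof.
  intros [Hr Hphi] H; split; [exact Hr|]; intros s Hs.
  destruct (Hphi s Hs) as (HQ & HD & _), (H s Hs) as (Hx & Hf & HQ' & Hy).
  split; [auto|]; split; [|exact Hy].
  revert HD; apply D_in_ext; [|exact Hf | exact Hs].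
  intros t Ht; apply H, Ht.
Qed.

Lemma flow_const x f Q r phi s y :
  flow x f Q r phi -> 0 <= s <= r -> y <> x -> phi s y = phi 0 y.
Proof. intros [_ H] Hs; apply H, Hs. Qed.

Lemma flow_agree z x f Q r phi v :
  z <> x -> occurs z f = false -> insens z Q ->
  flow x f Q r phi -> agree z (phi 0) v ->
  exists psi, flow x f Q r psi /\ psi 0 = v /\ agree z (phi r) (psi r).
Proof.
  intros Hzx Hf HQ H Hv.
  exists (fun s => upd (phi s) z (v z)); split; [|split].
  - apply (flow_transport _ _ _ _ _ _ _ _ H); intros s Hs; split; [|split; [|split]].
    + apply upd_other; congruence.
    + symmetry; apply (eval_agree z); [exact Hf | apply upd_agree].
    + apply HQ, upd_agree.
    + intros y Hy; destruct (Nat.eq_dec y z) as [->|Hyz]; [now rewrite !upd_same|].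
      rewrite !upd_other by exact Hyz; eapply flow_const; eassumption.
  - symmetry; apply agree_upd_eq, Hv.
  - apply upd_agree.
Qed.

Scheme fml_mut := Induction for fml Sort Prop
with game_mut := Induction for game Sort Prop.
Combined Scheme fml_game_ind from fml_mut, game_mut.

Definition overwritten_or_insens (x : var) (a : game) (X Y : sset) : Prop :=
  must_bind x a = true \/ (insens x X /\ insens x Y).

Lemma coincidence x :
  (forall P, free x P = false -> insens x (sem P)) /\
  (forall a, gfree x a = false -> forall X Y, overwritten_or_insens x a X Y ->
     insens x (angel a X Y) /\ insens x (demon a X Y)).
Proof.
  assert (modal : forall a P Q,
    (gfree x a = false -> forall X Y, overwritten_or_insens x a X Y ->
      insens x (angel a X Y) /\ insens x (demon a X Y)) ->
    (free x P = false -> insens x (sem P)) ->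
    (free x Q = false -> insens x (sem Q)) ->
    gfree x a || (negb (must_bind x a) && (free x P || free x Q)) = false ->
    insens x (angel a (sem P) (sem Q)) /\ insens x (demon a (sem P) (sem Q))).
  { intros a P Q IHa IHP IHQ H; apply orb_false_iff in H as [Ha H].
    apply IHa; [exact Ha|]; unfold overwritten_or_insens.
    destruct (must_bind x a); [left; reflexivity | right; simpl in H].
    apply orb_false_iff in H as [HP HQ]; auto. }
  apply fml_game_ind.
  - intros a b H w v Hwv; simpl in *.
    apply orb_false_iff in H as [Ha Hb].
    rewrite (eval_agree x a w v), (eval_agree x b w v) by assumption; auto.
  - intros P IH H; apply insens_compl, IH, H.
  - intros P IHP Q IHQ H w v Hwv [HP HQ]; simpl in H.
    apply orb_false_iff in H as [H H'].
    split; [revert HP; apply IHP | revert HQ; apply IHQ]; assumption.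
  - intros y P IH H w v Hwv Hw r; simpl in *.
    destruct (Nat.eqb_spec x y) as [->|Hxy].
    + rewrite <- (agree_upd_same y w v) by exact Hwv; apply Hw.
    + apply (IH H (upd w y r)); [apply agree_upd, Hwv | apply Hw].
  - intros y P IH H w v Hwv [r Hw]; exists r; simpl in *.
    destruct (Nat.eqb_spec x y) as [->|Hxy].
    + rewrite <- (agree_upd_same y w v) by exact Hwv; apply Hw.
    + apply (IH H (upd w y r)); [apply agree_upd, Hwv | apply Hw].
  - intros a IHa P IHP Q IHQ H; apply (modal a P Q IHa IHP IHQ H).
  - intros a IHa P IHP Q IHQ H; apply (modal a P Q IHa IHP IHQ H).
  - intros y e He X Y HXY; simpl in He.
    assert (H : forall X, Nat.eqb x y = true \/ insens x X ->
                insens x (fun w => X (upd w y (eval w e)))).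
    { intros Z HZ w v Hwv; rewrite (eval_agree x e w v He Hwv).
      destruct HZ as [HZ|HZ].
      - apply Nat.eqb_eq in HZ as <-; rewrite (agree_upd_same x w v) by exact Hwv; auto.
      - apply HZ, agree_upd, Hwv. }
    split; apply H; destruct HXY as [HXY|[HX HY]]; auto.
  - intros y f Q IHQ H X Y HXY; simpl in H.
    apply orb_false_iff in H as [H HQ]; apply orb_false_iff in H as [Hxy Hf].
    destruct HXY as [HXY|[HX HY]]; [simpl in HXY; congruence|].
    apply Nat.eqb_neq in Hxy; specialize (IHQ HQ).
    split; intros w v Hwv.
    + intros (r & phi & H & <- & Hr).
      destruct (flow_agree x y f _ r phi v Hxy Hf IHQ H Hwv) as (psi & H' & H0 & Hr').
      exists r, psi; split; [exact H'|]; split; [exact H0 | revert Hr; apply HX, Hr'].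
    + intros [H|(r & phi & H & <- & Hr & Hry)].
      * left; intros r phi H' <-; apply agree_sym in Hwv.
        destruct (flow_agree x y f _ r phi w Hxy Hf IHQ H' Hwv) as (psi & H'' & H0 & Hr').
        apply (HY (psi r)); [apply agree_sym, Hr' | apply H; assumption].
      * right; destruct (flow_agree x y f _ r phi v Hxy Hf IHQ H Hwv) as (psi & H' & H0 & Hr').
        exists r, psi; split; [exact H'|]; split; [exact H0|].
        split; [revert Hr; apply HX, Hr' | revert Hry; apply HY, Hr'].
  - intros Q IHQ H X Y [HXY|[HX HY]]; [discriminate|]; specialize (IHQ H).
    split; intros w v Hwv; simpl; rewrite (insens_iff x _ w v IHQ Hwv),
      ?(insens_iff x _ w v HX Hwv), ?(insens_iff x _ w v HY Hwv); auto.
  - intros a IHa b IHb H X Y HXY; simpl in H; apply orb_false_iff in H as [Ha Hb].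
    destruct (IHa Ha X Y) as [Hsa Hda].
    { destruct HXY as [HXY|HXY]; [left; apply andb_true_iff in HXY; apply HXY | right; exact HXY]. }
    destruct (IHb Hb X Y) as [Hsb Hdb].
    { destruct HXY as [HXY|HXY]; [left; apply andb_true_iff in HXY; apply HXY | right; exact HXY]. }
    split; intros w v Hwv; simpl;
      rewrite (insens_iff x _ w v Hsa Hwv), (insens_iff x _ w v Hsb Hwv),
        ?(insens_iff x _ w v Hda Hwv), ?(insens_iff x _ w v Hdb Hwv); auto.
  - intros a IHa b IHb H X Y HXY; simpl in H; apply orb_false_iff in H as [Ha Hb].
    apply (IHa Ha); unfold overwritten_or_insens in *; simpl in HXY.
    destruct (must_bind x a); [left; reflexivity | right].
    apply (IHb Hb); exact HXY.
  - intros a IHa H X Y HXY; apply and_comm, IHa; [exact H|].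
    destruct HXY as [HXY|[HX HY]]; [left; exact HXY | right; auto].
  - intros a IHa H X Y [HXY|[HX HY]]; [discriminate|].
    simpl in H; specialize (IHa H).
    assert (Hm : insens x (meet a X Y)).
    { apply lfp_insens; [apply meet_step_mono|]; intros Z HZ w v Hwv.
      destruct (IHa Z Z) as [Hs Hd]; [right; auto|].
      rewrite (insens_iff x _ w v HX Hwv), (insens_iff x _ w v HY Hwv),
        (insens_iff x _ w v Hs Hwv), (insens_iff x _ w v Hd Hwv); auto. }
    assert (Hr : insens x (reach a X)).
    { apply lfp_insens; [apply reach_step_mono|]; intros Z HZ w v Hwv.
      destruct (IHa Z (compl Z)) as [Hs Hd]; [right; auto using insens_compl|].
      rewrite (insens_iff x _ w v HX Hwv), (insens_iff x _ w v Hs Hwv); auto. }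
    assert (Ht : insens x (stay a Y)).
    { apply gfp_insens; [apply stay_step_mono|]; intros Z HZ w v Hwv.
      destruct (IHa (compl Z) Z) as [Hs Hd]; [right; auto using insens_compl|].
      rewrite (insens_iff x _ w v HY Hwv), (insens_iff x _ w v Hd Hwv); auto. }
    split; intros w v Hwv [Hw|Hw]; [left | right | left | right]; revert Hw;
      [apply Hr | apply Hm | apply Ht | apply Hm]; exact Hwv.
Qed.

Lemma free_insens x P : free x P = false -> insens x (sem P).
Proof. apply (proj1 (coincidence x)). Qed.

(** * Substitution *)

Definition assigned (x : var) (e : term) (w : state) : state := upd w x (eval w e).
Definition pullback (x : var) (e : term) (X : sset) : sset :=
  fun w => X (assigned x e w).

Lemma assigned_agree x e w : agree x (assigned x e w) w.
Proof. apply agree_sym, upd_agree. Qed.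

Lemma pullback_insens x e X : insens x X -> pullback x e X = X.
Proof. intros H; apply sset_ext; intros w; apply (insens_iff x X _ w H), assigned_agree. Qed.

Lemma assigned_upd x e w y r : y <> x -> occurs y e = false ->
  assigned x e (upd w y r) = upd (assigned x e w) y r.
Proof.
  intros Hyx He; unfold assigned.
  rewrite <- (eval_agree y e w) by (exact He || apply upd_agree).
  apply upd_comm; exact Hyx.
Qed.

Lemma eval_tsubst x e t w : eval w (tsubst x e t) = eval (assigned x e w) t.
Proof.
  induction t as [y|c|a IHa b IHb|a IHa b IHb]; simpl; try congruence.
  unfold assigned, upd; destruct (Nat.eqb y x); reflexivity.
Qed.

(* The relation between a postcondition [X] and what substitution turns it into,
   by the status of its position. *)
Definition linked (x : var) (e : term) (s : status) (X X' : sset) : Prop :=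
  match s with
  | Live => X' = pullback x e X
  | Dead => X' = X
  | Clash => X' = X /\ insens x X
  end.

Lemma guarded_linked x e s P o P' :
  (forall P'', o = Some P'' -> sem P'' = pullback x e (sem P)) ->
  guarded s (free x P) P o = Some P' -> linked x e s (sem P) (sem P').
Proof.
  intros Ho H; destruct s; simpl in *; [auto | congruence|].
  destruct (free x P) eqn:HP; [discriminate|]; injection H as <-.
  split; [reflexivity | apply free_insens, HP].
Qed.

Lemma must_may_bind x a : must_bind x a = true -> may_bind x a = true.
Proof.
  induction a; simpl; rewrite ?andb_true_iff, ?orb_true_iff; tauto || discriminate.
Qed.

Lemma behind_game_dead x e a :
  behind_game x e a = Dead <-> must_bind x a = true.
Proof.
  unfold behind_game; destruct (must_bind x a); [tauto|].
  destruct (existsb _ _); split; discriminate.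
Qed.

Lemma behind_game_live x e a :
  behind_game x e a = Live <->
  may_bind x a = false /\ existsb (fun y => may_bind y a) (tvars e) = false.
Proof.
  unfold behind_game; simpl; pose proof (must_may_bind x a).
  destruct (must_bind x a);
    [rewrite H by reflexivity; split; [discriminate | intuition discriminate]|].
  rewrite <- orb_false_iff; destruct (_ || _); split; congruence.
Qed.

Lemma existsb_or {A} (f g : A -> bool) l :
  existsb (fun y => f y || g y) l = existsb f l || existsb g l.
Proof.
  induction l as [|y l IH]; simpl; [reflexivity|].
  rewrite IH; destruct (f y), (g y), (existsb f l), (existsb g l); reflexivity.
Qed.

Lemma existsb_eqb_occurs y e :
  existsb (fun z => Nat.eqb z y) (tvars e) = occurs y e.
Proof.
  unfold occurs; induction (tvars e) as [|z l IH]; simpl; [reflexivity|].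
  now rewrite IH, Nat.eqb_sym.
Qed.

Lemma behind_choice x e a b :
  behind_game x e (Choice a b) =
  match behind_game x e a, behind_game x e b with
  | Live, Live => Live
  | Dead, Dead => Dead
  | _, _ => Clash
  end.
Proof.
  pose proof (must_may_bind x a) as Ha; pose proof (must_may_bind x b) as Hb.
  unfold behind_game; simpl; rewrite existsb_or.
  destruct (existsb (fun y => may_bind y a) (tvars e)),
    (existsb (fun y => may_bind y b) (tvars e)).
  all: destruct (must_bind x a), (must_bind x b); simpl;
    rewrite ?Ha, ?Hb by reflexivity; simpl; try reflexivity;
    destruct (may_bind x a); simpl; try reflexivity;
    destruct (may_bind x b); reflexivity.
Qed.

Lemma linked_choice x e a b X X' :
  linked x e (behind_game x e (Choice a b)) X X' ->
  linked x e (behind_game x e a) X X' /\ linked x e (behind_game x e b) X X'.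
Proof.
  rewrite behind_choice.
  destruct (behind_game x e a), (behind_game x e b); simpl; auto;
    intros [-> H]; pose proof (pullback_insens x e X H); auto.
Qed.

Lemma linked_seq_live x e a b X X' : behind_game x e a = Live ->
  linked x e (behind_game x e (Seq a b)) X X' ->
  linked x e (behind_game x e b) X X'.
Proof.
  intros H; apply behind_game_live in H as [Hx He].
  assert (Hm : must_bind x a = false).
  { destruct (must_bind x a) eqn:E; [|reflexivity].
    apply must_may_bind in E; congruence. }
  unfold behind_game; simpl; rewrite existsb_or, Hm, Hx, He; auto.
Qed.

Lemma linked_assign x e y t X X' :
  linked x e (behind_game x e (Assign y t)) X X' ->
  (fun w => X' (upd w y (eval w (tsubst x e t)))) =
  pullback x e (fun w => X (upd w y (eval w t))).
Proof.
  intros H; apply sset_ext; intros w; unfold pullback; rewrite eval_tsubst.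
  set (r := eval _ t); unfold behind_game in H; simpl in H.
  destruct (Nat.eqb_spec x y) as [<-|Hxy]; simpl in H.
  - subst X'; rewrite (agree_upd_same x (assigned x e w) w) by apply assigned_agree.
    reflexivity.
  - rewrite existsb_eqb_occurs in H; destruct (occurs y e) eqn:He; simpl in H.
    + destruct H as [-> H]; apply insens_iff with x; [exact H|].
      apply agree_upd, upd_agree.
    + subst X'; unfold pullback; rewrite assigned_upd by auto; reflexivity.
Qed.

Lemma flow_pushforward x e y f Q r phi : y <> x -> occurs y e = false ->
  flow y (tsubst x e f) (pullback x e Q) r phi ->
  flow y f Q r (fun s => assigned x e (phi s)).
Proof.
  intros Hyx He H; apply (flow_transport _ _ _ _ _ _ _ _ H).
  intros s Hs; split; [apply upd_other, Hyx|]; split; [symmetry; apply eval_tsubst|].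
  split; [intros HQ; exact HQ|].
  assert (Hphi : agree y (phi s) (phi 0)) by (intros z; apply (flow_const _ _ _ _ _ _ _ H Hs)).
  intros z Hz; unfold assigned; rewrite (eval_agree y e _ _ He Hphi).
  apply (agree_upd y _ _ x _ Hphi z Hz).
Qed.

Lemma flow_pullback x e y f Q r phi w : y <> x -> occurs y e = false ->
  flow y f Q r phi -> phi 0 = assigned x e w ->
  exists psi, flow y (tsubst x e f) (pullback x e Q) r psi /\ psi 0 = w /\
              assigned x e (psi r) = phi r.
Proof.
  intros Hyx He H H0.
  set (psi s := upd (phi s) x (w x)).
  assert (Hw : psi 0 = w).
  { unfold psi; rewrite H0; rewrite (agree_upd_same x _ w) by apply assigned_agree.
    apply upd_id. }
  assert (Hc : forall s, 0 <= s <= r -> agree y (psi s) (psi 0)).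
  { intros s Hs z Hz; unfold psi; apply agree_upd with (x := y); [|exact Hz].
    intros z' Hz'; eapply flow_const; eassumption. }
  assert (Hphi : forall s, 0 <= s <= r -> assigned x e (psi s) = phi s).
  { intros s Hs; unfold assigned.
    rewrite (eval_agree y e _ _ He (Hc s Hs)), Hw; unfold psi; rewrite upd_upd.
    replace (eval w e) with (phi s x); [apply upd_id|].
    rewrite (flow_const _ _ _ _ _ _ _ H Hs) by congruence.
    rewrite H0; apply upd_same. }
  exists psi; split; [|split; [exact Hw|]].
  - apply (flow_transport _ _ _ _ _ _ _ _ H); intros s Hs.
    split; [apply upd_other, Hyx|].
    rewrite eval_tsubst; unfold pullback; rewrite Hphi by exact Hs.
    split; [reflexivity|]; split; [auto | apply Hc, Hs].
  - apply Hphi; split; [apply H | apply Rle_refl].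
Qed.

Lemma lfp_pullback x e F F' : monotone F' ->
  (forall Z, F' (pullback x e Z) = pullback x e (F Z)) ->
  lfp F' = pullback x e (lfp F).
Proof.
  intros HF' H; apply sset_ext; intros w; split.
  - intros Hw Z HZ; apply (Hw (pullback x e Z)); intros v; rewrite H; apply HZ.
  - intros Hw.
    apply (Hw (fun u => forall v, assigned x e v = u -> lfp F' v)); [|reflexivity].
    intros u Hu v <-; apply lfp_fold; [exact HF'|].
    change (pullback x e (F (fun u => forall v, assigned x e v = u -> lfp F' v)) v) in Hu.
    rewrite <- H in Hu; revert Hu; apply HF'; intros u Hu; apply Hu; reflexivity.
Qed.

Lemma gfp_pullback x e F F' : monotone F' ->
  (forall Z, F' (pullback x e Z) = pullback x e (F Z)) ->
  gfp F' = pullback x e (gfp F).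
Proof.
  intros HF' H; apply sset_ext; intros w; split.
  - intros (Z & HZ & Hw).
    exists (fun u => exists v, assigned x e v = u /\ Z v); split; [|exists w; auto].
    intros u (v & <- & Hv).
    change (pullback x e (F (fun u => exists v, assigned x e v = u /\ Z v)) v).
    rewrite <- H; apply HZ in Hv; revert Hv; apply HF'.
    intros u Hu; exists u; auto.
  - intros (Z & HZ & Hw); exists (pullback x e Z); split; [|exact Hw].
    intros v; rewrite H; apply HZ.
Qed.

Definition subst_linked (x : var) (e : term) (a a' : game) : Prop :=
  forall X Y X' Y',
    linked x e (behind_game x e a) X X' -> linked x e (behind_game x e a) Y Y' ->
    angel a' X' Y' = pullback x e (angel a X Y) /\
    demon a' X' Y' = pullback x e (demon a X Y).

Lemma subst_linked_same x e a :
  gfree x a = false -> must_bind x a = false -> behind_game x e a = Clash ->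
  subst_linked x e a a.
Proof.
  intros Ha Hm Hb X Y X' Y'; rewrite Hb; intros [-> HX] [-> HY].
  destruct (proj2 (coincidence x) a Ha X Y) as [Hs Hd]; [right; auto|].
  split; symmetry; apply pullback_insens; assumption.
Qed.

Lemma subst_linked_star x e a a' : behind_game x e a = Live ->
  subst_linked x e a a' ->
  forall X Y, angel (Star a') (pullback x e X) (pullback x e Y) =
                pullback x e (angel (Star a) X Y) /\
              demon (Star a') (pullback x e X) (pullback x e Y) =
                pullback x e (demon (Star a) X Y).
Proof.
  intros Hb H X Y; unfold subst_linked in H; rewrite Hb in H.
  assert (Hm : meet a' (pullback x e X) (pullback x e Y) = pullback x e (meet a X Y)).
  { apply lfp_pullback; [apply meet_step_mono|]; intros Z.
    destruct (H Z Z _ _ eq_refl eq_refl) as [-> ->]; reflexivity. }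
  assert (Hr : reach a' (pullback x e X) = pullback x e (reach a X)).
  { apply lfp_pullback; [apply reach_step_mono|]; intros Z.
    destruct (H Z (compl Z) _ _ eq_refl eq_refl) as [Hs _].
    change (compl (pullback x e Z)) with (pullback x e (compl Z)); rewrite Hs; reflexivity. }
  assert (Ht : stay a' (pullback x e Y) = pullback x e (stay a Y)).
  { apply gfp_pullback; [apply stay_step_mono|]; intros Z.
    destruct (H (compl Z) Z _ _ eq_refl eq_refl) as [_ Hd].
    change (compl (pullback x e Z)) with (pullback x e (compl Z)); rewrite Hd; reflexivity. }
  rewrite !angel_star, !demon_star, Hm, Hr, Ht; split; reflexivity.
Qed.

Lemma linked_seq x e a b b' X Y X' Y' :
  (forall b'', gsubst x e b = Some b'' -> subst_linked x e b b'') ->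
  guarded (behind_game x e a) (gfree x b) b (gsubst x e b) = Some b' ->
  linked x e (behind_game x e (Seq a b)) X X' ->
  linked x e (behind_game x e (Seq a b)) Y Y' ->
  linked x e (behind_game x e a) (angel b X Y) (angel b' X' Y') /\
  linked x e (behind_game x e a) (demon b X Y) (demon b' X' Y').
Proof.
  intros IHb Hb HX HY; destruct (behind_game x e a) eqn:E; simpl in *.
  - apply (linked_seq_live x e a b) in HX; [|exact E].
    apply (linked_seq_live x e a b) in HY; [|exact E].
    apply (IHb b' Hb _ _ _ _ HX HY).
  - injection Hb as <-.
    assert (Hs : behind_game x e (Seq a b) = Dead).
    { apply behind_game_dead; simpl; apply behind_game_dead in E; now rewrite E. }
    rewrite Hs in HX, HY; simpl in HX, HY; subst; auto.
  - destruct (gfree x b) eqn:Hf; [discriminate|]; injection Hb as <-.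
    assert (H : X' = X /\ Y' = Y /\ overwritten_or_insens x b X Y).
    { unfold overwritten_or_insens; destruct (must_bind x b) eqn:Hm.
      - assert (Hs : behind_game x e (Seq a b) = Dead).
        { apply behind_game_dead; simpl; now rewrite Hm, orb_true_r. }
        rewrite Hs in HX, HY; auto.
      - assert (Hs : behind_game x e (Seq a b) = Clash).
        { destruct (behind_game x e (Seq a b)) eqn:Hs; [| |reflexivity]; exfalso.
          - apply behind_game_live in Hs; simpl in Hs.
            rewrite existsb_or, !orb_false_iff in Hs.
            assert (E' : behind_game x e a = Live) by (apply behind_game_live; tauto).
            congruence.
          - apply behind_game_dead in Hs; simpl in Hs; rewrite Hm, orb_false_r in Hs.
            apply behind_game_dead with (e := e) in Hs; congruence. }
        rewrite Hs in HX, HY; simpl in HX, HY; tauto. }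
    destruct H as (-> & -> & H).
    destruct (proj2 (coincidence x) b Hf X Y H); auto.
Qed.

Lemma omap1_some {A B} (f : A -> B) o b :
  omap1 f o = Some b -> exists a, o = Some a /\ b = f a.
Proof. destruct o; [intros [= <-]; eauto | discriminate]. Qed.

Lemma omap2_some {A B C} (f : A -> B -> C) o1 o2 c :
  omap2 f o1 o2 = Some c -> exists a b, o1 = Some a /\ o2 = Some b /\ c = f a b.
Proof. destruct o1, o2; try discriminate; intros [= <-]; eauto. Qed.

Lemma omap3_some {A B C D} (f : A -> B -> C -> D) o1 o2 o3 d :
  omap3 f o1 o2 o3 = Some d ->
  exists a b c, o1 = Some a /\ o2 = Some b /\ o3 = Some c /\ d = f a b c.
Proof. destruct o1, o2, o3; try discriminate; intros [= <-]; eauto 10. Qed.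

Lemma linked_quantifier x e y P P' r w :
  linked x e (behind_quantifier x e y) (sem P) (sem P') ->
  (sem P' (upd w y r) <-> sem P (upd (assigned x e w) y r)).
Proof.
  unfold behind_quantifier; destruct (Nat.eqb_spec y x) as [->|Hyx]; simpl.
  - intros ->; rewrite (agree_upd_same x (assigned x e w) w) by apply assigned_agree.
    reflexivity.
  - destruct (occurs y e) eqn:He; simpl.
    + intros [-> H]; apply insens_iff with x; [exact H|]; apply agree_upd, upd_agree.
    + intros ->; unfold pullback; rewrite assigned_upd by assumption; reflexivity.
Qed.

Lemma subst_linked_ode x e y f Q Q' : y <> x -> occurs y e = false ->
  sem Q' = pullback x e (sem Q) ->
  subst_linked x e (ODE y f Q) (ODE y (tsubst x e f) Q').
Proof.
  intros Hyx He HQ X Y X' Y'.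
  replace (behind_game x e (ODE y f Q)) with Live.
  2: { symmetry; apply behind_game_live; simpl; rewrite existsb_eqb_occurs.
       split; [apply Nat.eqb_neq; congruence | exact He]. }
  intros -> ->; simpl; rewrite HQ; split; apply sset_ext; intros w; split.
  - intros (r & phi & H & <- & Hr).
    exists r, (fun s => assigned x e (phi s)).
    split; [apply flow_pushforward; assumption | auto].
  - intros (r & phi & H & H0 & Hr).
    destruct (flow_pullback _ _ _ _ _ _ _ w Hyx He H H0) as (psi & H' & H0' & Hr').
    exists r, psi; unfold pullback; rewrite Hr'; auto.
  - intros [H|(r & phi & H & <- & Hr & Hr2)].
    + left; intros r phi H' H0.
      destruct (flow_pullback _ _ _ _ _ _ _ w Hyx He H' H0) as (psi & H2 & H0' & <-).
      apply (H r psi H2 H0').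
    + right; exists r, (fun s => assigned x e (phi s)).
      split; [apply flow_pushforward; assumption | auto].
  - intros [H|(r & phi & H & H0 & Hr & Hr2)].
    + left; intros r phi H' <-.
      apply (H r (fun s => assigned x e (phi s)));
        [apply flow_pushforward; assumption | reflexivity].
    + right; destruct (flow_pullback _ _ _ _ _ _ _ w Hyx He H H0) as (psi & H' & H0' & Hr').
      exists r, psi; unfold pullback; rewrite Hr'; auto.
Qed.

Lemma substitution x e :
  (forall P P', fsubst x e P = Some P' -> sem P' = pullback x e (sem P)) /\
  (forall a a', gsubst x e a = Some a' -> subst_linked x e a a').
Proof.
  apply fml_game_ind.
  - intros a b P' [= <-]; apply sset_ext; intros w; simpl; unfold pullback.
    rewrite !eval_tsubst; reflexivity.
  - intros P IH P' H; apply omap1_some in H as (P1 & H & ->).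
    simpl; rewrite (IH P1 H); reflexivity.
  - intros P IHP Q IHQ P' H; apply omap2_some in H as (P1 & Q1 & HP & HQ & ->).
    simpl; rewrite (IHP P1 HP), (IHQ Q1 HQ); reflexivity.
  - intros y P IH P' H; apply omap1_some in H as (P1 & H & ->).
    apply (guarded_linked x e) in H; [|exact IH].
    apply sset_ext; intros w; unfold pullback; simpl.
    split; intros Hw r; apply (linked_quantifier _ _ _ _ _ r w H), Hw.
  - intros y P IH P' H; apply omap1_some in H as (P1 & H & ->).
    apply (guarded_linked x e) in H; [|exact IH].
    apply sset_ext; intros w; unfold pullback; simpl.
    split; intros [r Hw]; exists r; apply (linked_quantifier _ _ _ _ _ r w H), Hw.
  - intros a IHa P IHP Q IHQ P' H.
    apply omap3_some in H as (a1 & P1 & Q1 & Ha & HP & HQ & ->).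
    apply (guarded_linked x e) in HP; [|exact IHP]; apply (guarded_linked x e) in HQ; [|exact IHQ].
    apply (IHa a1 Ha _ _ _ _ HP HQ).
  - intros a IHa P IHP Q IHQ P' H.
    apply omap3_some in H as (a1 & P1 & Q1 & Ha & HP & HQ & ->).
    apply (guarded_linked x e) in HP; [|exact IHP]; apply (guarded_linked x e) in HQ; [|exact IHQ].
    apply (IHa a1 Ha _ _ _ _ HP HQ).
  - intros y t a' [= <-] X Y X' Y' HX HY; split; apply linked_assign; assumption.
  - intros y f Q IHQ a' H; simpl in H; unfold inside_ode in H.
    destruct (Nat.eqb_spec y x) as [->|Hyx]; simpl in H.
    { rewrite Nat.eqb_refl in H; discriminate. }
    destruct (occurs y e) eqn:He; simpl in H.
    + destruct (_ || free x Q) eqn:Hf; [discriminate|]; injection H as <-.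
      apply subst_linked_same; [exact Hf | apply Nat.eqb_neq; congruence|].
      unfold behind_game; simpl; rewrite existsb_eqb_occurs, He, orb_true_r.
      rewrite (proj2 (Nat.eqb_neq x y)) by congruence; reflexivity.
    + apply omap1_some in H as (Q1 & HQ & ->).
      apply subst_linked_ode; auto.
  - intros Q IHQ a' H; apply omap1_some in H as (Q1 & H & ->).
    intros X Y X' Y'.
    replace (behind_game x e (Test Q)) with Live
      by (symmetry; apply behind_game_live; simpl; split; [reflexivity|];
          induction (tvars e); auto).
    intros -> ->; simpl; rewrite (IHQ Q1 H); split; reflexivity.
  - intros a IHa b IHb a' H; apply omap2_some in H as (a1 & b1 & Ha & Hb & ->).
    intros X Y X' Y' HX HY.
    apply linked_choice in HX as [HXa HXb]; apply linked_choice in HY as [HYa HYb].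
    destruct (IHa a1 Ha _ _ _ _ HXa HYa) as [Hsa Hda].
    destruct (IHb b1 Hb _ _ _ _ HXb HYb) as [Hsb Hdb].
    simpl; rewrite Hsa, Hda, Hsb, Hdb; split; reflexivity.
  - intros a IHa b IHb a' H; apply omap2_some in H as (a1 & b1 & Ha & Hb & ->).
    intros X Y X' Y' HX HY.
    destruct (linked_seq x e a b b1 X Y X' Y') as [Hs Hd]; auto.
    apply (IHa a1 Ha _ _ _ _ Hs Hd).
  - intros a IHa a' H; apply omap1_some in H as (a1 & H & ->).
    intros X Y X' Y' HX HY; apply and_comm, (IHa a1 H _ _ _ _ HY HX).
  - intros a IHa a' H; apply omap1_some in H as (a1 & H & ->).
    destruct (behind_game x e (Star a)) eqn:E; simpl in H.
    + intros X Y X' Y'; rewrite E; intros -> ->.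
      apply subst_linked_star; [|apply IHa, H].
      apply behind_game_live in E; apply behind_game_live, E.
    + apply behind_game_dead in E; discriminate.
    + destruct (gfree x a) eqn:Hf; [discriminate|]; injection H as <-.
      apply subst_linked_same; auto.
Qed.

(** * Uniqueness of solutions *)

Definition clamp (r s : R) : R := Rmax 0 (Rmin s r).

Lemma clamp_bounds r s : 0 <= r -> 0 <= clamp r s <= r.
Proof.
  intros Hr; unfold clamp; split; [apply Rmax_l|].
  apply Rmax_lub; [exact Hr | apply Rmin_r].
Qed.

Lemma clamp_id r s : 0 <= s <= r -> clamp r s = s.
Proof. intros Hs; unfold clamp; rewrite Rmin_left, Rmax_right; lra. Qed.

Lemma clamp_dist r s t : Rabs (clamp r s - clamp r t) <= Rabs (s - t).
Proof.
  unfold clamp, Rmax, Rmin.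
  destruct (Rle_dec s r), (Rle_dec t r); repeat destruct (Rle_dec _ _);
    unfold Rabs; repeat destruct (Rcase_abs _); lra.
Qed.

Lemma D_in_clamp_continuity z g r s : 0 <= r ->
  (forall s, 0 <= s <= r -> D_in z g (fun t => 0 <= t <= r) s) ->
  continuity_pt (fun t => z (clamp r t)) s.
Proof.
  intros Hr Hz.
  intros eps Heps.
  pose proof (clamp_bounds r s Hr) as Hs.
  destruct (cont_deriv _ _ _ _ (Hz _ Hs) eps Heps) as (alp & Halp & H).
  exists alp; split; [exact Halp|]; intros t [_ Ht].
  destruct (Req_dec (clamp r t) (clamp r s)) as [E|E].
  - simpl; unfold Rdist; rewrite E, Rminus_diag, Rabs_R0; exact Heps.
  - apply H; split; [split; [apply clamp_bounds, Hr | congruence]|].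
    eapply Rle_lt_trans; [apply clamp_dist | exact Ht].
Qed.

Lemma D_in_clamp_derivable z g r s :
  (forall s, 0 <= s <= r -> D_in z g (fun t => 0 <= t <= r) s) ->
  0 < s < r -> derivable_pt_lim (fun t => z (clamp r t)) s (g s).
Proof.
  intros Hz Hs eps Heps.
  destruct (Hz s) with (eps := eps) as (alp & Halp & H); [lra | exact Heps|].
  assert (Hd : 0 < Rmin alp (Rmin s (r - s))) by (repeat apply Rmin_pos; lra).
  exists (mkposreal _ Hd); simpl; intros h Hh0 Hh.
  assert (Hh1 : Rabs h < alp) by (eapply Rlt_le_trans; [exact Hh | apply Rmin_l]).
  assert (Hh2 : Rabs h < s /\ Rabs h < r - s).
  { pose proof (Rmin_r alp (Rmin s (r - s))); pose proof (Rmin_l s (r - s));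
    pose proof (Rmin_r s (r - s)); lra. }
  assert (Hh3 : 0 <= s + h <= r).
  { pose proof (Rle_abs h); pose proof (Rle_abs (- h)); rewrite Rabs_Ropp in *; lra. }
  rewrite !clamp_id by lra.
  specialize (H (s + h)); simpl in H; unfold Rdist in H.
  replace (s + h - s) with h in H by ring.
  apply H; split; [split; [exact Hh3 | intros E; apply Hh0; lra] | exact Hh1].
Qed.

Lemma D_in_bounded z g r : 0 <= r ->
  (forall s, 0 <= s <= r -> D_in z g (fun t => 0 <= t <= r) s) ->
  exists M, forall s, 0 <= s <= r -> Rabs (z s) <= M.
Proof.
  intros Hr Hz.
  destruct (continuity_ab_maj (fun t => Rabs (z (clamp r t))) 0 r Hr) as (m & Hm & _).
  - intros m' _; apply (continuity_pt_comp (fun t => z (clamp r t)) Rabs);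
      [apply (D_in_clamp_continuity z g r m' Hr Hz) | apply Rcontinuity_abs].
  - exists (Rabs (z (clamp r m))); intros s Hs.
    rewrite <- (clamp_id r s Hs); apply Hm, Hs.
Qed.

(* Gronwall: [d^2 exp (-2 L s)] is nonincreasing. *)
Lemma gronwall_zero (d d' : R -> R) L r : 0 <= r -> d 0 = 0 ->
  (forall s, 0 <= s <= r -> D_in d d' (fun t => 0 <= t <= r) s) ->
  (forall s, 0 <= s <= r -> Rabs (d' s) <= L * Rabs (d s)) ->
  d r = 0.
Proof.
  intros Hr H0 Hd HL.
  set (E s := Rsqr (d (clamp r s)) * exp (- 2 * L * s)).
  set (E' s := (2 * d s * d' s - 2 * L * Rsqr (d s)) * exp (- 2 * L * s)).
  assert (HE : forall s, derivable_pt_lim (fun t => exp (- 2 * L * t)) s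
                           (- 2 * L * exp (- 2 * L * s))).
  { intros s; apply is_derive_Reals; auto_derive; [exact I | ring]. }
  destruct (MVT_gen E 0 r E') as (c & Hc & H); rewrite ?Rmin_left, ?Rmax_right in * by lra.
  - intros s Hs; apply is_derive_Reals.
    replace (E' s) with ((d' s * d (clamp r s) + d (clamp r s) * d' s) * exp (- 2 * L * s)
        + Rsqr (d (clamp r s)) * (- 2 * L * exp (- 2 * L * s)))
      by (unfold E', Rsqr; rewrite clamp_id by lra; ring).
    pose proof (D_in_clamp_derivable d d' r s Hd Hs) as Hds.
    apply (derivable_pt_lim_mult _ _ s _ _ (derivable_pt_lim_mult _ _ s _ _ Hds Hds) (HE s)).
  - intros s _; apply (continuity_pt_mult (fun t => Rsqr (d (clamp r t)))).
    + apply continuity_pt_mult; apply (D_in_clamp_continuity d d' r _ Hr Hd).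
    + apply derivable_continuous_pt; eexists; apply HE.
  - assert (HE' : E' c <= 0).
    { unfold E'; pose proof (exp_pos (- 2 * L * c)); pose proof (HL c Hc) as HLc.
      assert (d c * d' c <= L * Rsqr (d c)); [|nra].
      rewrite (Rsqr_abs (d c)).
      eapply Rle_trans; [apply Rle_abs|]; rewrite Rabs_mult.
      unfold Rsqr; pose proof (Rabs_pos (d c)); nra. }
    assert (HEr : E r <= 0).
    { assert (E 0 = 0) by (unfold E; rewrite clamp_id, H0 by lra; unfold Rsqr; ring).
      nra. }
    unfold E in HEr; rewrite clamp_id in HEr by lra.
    pose proof (exp_pos (- 2 * L * r)); apply Rsqr_0_uniq.
    pose proof (Rle_0_sqr (d r)); nra.
Qed.

Lemma eval_bounded x f w M : exists B, 0 <= B /\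
  forall a, Rabs a <= M -> Rabs (eval (upd w x a) f) <= B.
Proof.
  induction f as [y|c|f1 (B1 & HB1 & H1) f2 (B2 & HB2 & H2)
                 |f1 (B1 & HB1 & H1) f2 (B2 & HB2 & H2)]; simpl.
  - exists (Rabs M + Rabs (w y)).
    pose proof (Rabs_pos M); pose proof (Rabs_pos (w y)); split; [lra|].
    intros a Ha; unfold upd; pose proof (Rle_abs M).
    destruct (Nat.eqb y x); lra.
  - exists (Rabs c); split; [apply Rabs_pos | intros; apply Rle_refl].
  - exists (B1 + B2); split; [lra|]; intros a Ha.
    eapply Rle_trans; [apply Rabs_triang|]; specialize (H1 a Ha); specialize (H2 a Ha); lra.
  - exists (B1 * B2); split; [nra|]; intros a Ha; rewrite Rabs_mult.
    apply Rmult_le_compat; auto using Rabs_pos.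
Qed.

Lemma eval_lipschitz x f w M : exists L, 0 <= L /\
  forall a b, Rabs a <= M -> Rabs b <= M ->
    Rabs (eval (upd w x a) f - eval (upd w x b) f) <= L * Rabs (a - b).
Proof.
  induction f as [y|c|f1 (L1 & HL1 & H1) f2 (L2 & HL2 & H2)
                 |f1 (L1 & HL1 & H1) f2 (L2 & HL2 & H2)]; simpl.
  - exists 1; split; [lra|]; intros a b _ _; unfold upd.
    destruct (Nat.eqb y x); [lra|].
    rewrite Rminus_diag, Rabs_R0; pose proof (Rabs_pos (a - b)); lra.
  - exists 0; split; [lra|]; intros a b _ _; rewrite Rminus_diag, Rabs_R0; lra.
  - exists (L1 + L2); split; [lra|]; intros a b Ha Hb.
    specialize (H1 a b Ha Hb); specialize (H2 a b Ha Hb).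
    match goal with |- Rabs (?u + ?v - (?u' + ?v')) <= _ =>
      replace (u + v - (u' + v')) with ((u - u') + (v - v')) by ring end.
    eapply Rle_trans; [apply Rabs_triang | lra].
  - destruct (eval_bounded x f1 w M) as (B1 & HB1 & HB1').
    destruct (eval_bounded x f2 w M) as (B2 & HB2 & HB2').
    exists (L1 * B2 + B1 * L2); split; [nra|]; intros a b Ha Hb.
    specialize (H1 a b Ha Hb); specialize (H2 a b Ha Hb).
    specialize (HB1' b Hb); specialize (HB2' a Ha).
    match goal with |- Rabs (?u * ?v - ?u' * ?v') <= _ =>
      replace (u * v - u' * v') with ((u - u') * v + u' * (v - v')) by ring end.
    eapply Rle_trans; [apply Rabs_triang|]; rewrite !Rabs_mult.
    rewrite Rmult_plus_distr_r; apply Rplus_le_compat.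
    + replace (L1 * B2 * Rabs (a - b)) with ((L1 * Rabs (a - b)) * B2) by ring.
      apply Rmult_le_compat; auto using Rabs_pos.
    + rewrite Rmult_assoc; apply Rmult_le_compat; auto using Rabs_pos.
Qed.

Lemma flow_unique x f Q Q' r phi psi :
  flow x f Q r phi -> flow x f Q' r psi -> phi 0 = psi 0 -> phi r = psi r.
Proof.
  intros Hphi Hpsi H0.
  assert (Hr : 0 <= r) by apply Hphi.
  set (z1 s := phi s x); set (z2 s := psi s x).
  set (g a := eval (upd (phi 0) x a) f).
  assert (E1 : forall s, 0 <= s <= r -> phi s = upd (phi 0) x (z1 s)).
  { intros s Hs; apply agree_upd_eq; intros y Hy; symmetry.
    eapply flow_const; eassumption. }
  assert (E2 : forall s, 0 <= s <= r -> psi s = upd (phi 0) x (z2 s)).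
  { intros s Hs; rewrite H0; apply agree_upd_eq; intros y Hy; symmetry.
    eapply flow_const; eassumption. }
  assert (D1 : forall s, 0 <= s <= r -> D_in z1 (fun t => g (z1 t)) (fun t => 0 <= t <= r) s).
  { intros s Hs; destruct Hphi as [_ H]; destruct (H s Hs) as (_ & HD & _).
    revert HD; apply D_in_ext; [reflexivity | unfold g; now rewrite <- E1 | exact Hs]. }
  assert (D2 : forall s, 0 <= s <= r -> D_in z2 (fun t => g (z2 t)) (fun t => 0 <= t <= r) s).
  { intros s Hs; destruct Hpsi as [_ H]; destruct (H s Hs) as (_ & HD & _).
    revert HD; apply D_in_ext; [reflexivity | unfold g; now rewrite <- E2 | exact Hs]. }
  destruct (D_in_bounded _ _ r Hr D1) as (M1 & HM1).
  destruct (D_in_bounded _ _ r Hr D2) as (M2 & HM2).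
  destruct (eval_lipschitz x f (phi 0) (Rmax M1 M2)) as (L & _ & HL).
  assert (H : z1 r - z2 r = 0).
  { apply (gronwall_zero (fun s => z1 s - z2 s) (fun s => g (z1 s) - g (z2 s)) L);
      [exact Hr | unfold z1, z2; rewrite H0; ring | |].
    - intros s Hs; apply Dminus; auto.
    - intros s Hs; apply HL.
      + eapply Rle_trans; [apply HM1, Hs | apply Rmax_l].
      + eapply Rle_trans; [apply HM2, Hs | apply Rmax_r]. }
  rewrite E1, E2 by lra; f_equal; lra.
Qed.

(** * Soundness *)

Lemma sem_or P Q w : sem (Or P Q) w <-> sem P w \/ sem Q w.
Proof. simpl; tauto. Qed.

Lemma sem_imp P Q w : sem (Imp P Q) w <-> (sem P w -> sem Q w).
Proof. unfold Imp; rewrite sem_or; simpl; tauto. Qed.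

Lemma sem_iff P Q w : sem (Iff P Q) w <-> (sem P w <-> sem Q w).
Proof. unfold Iff; cbn [sem]; rewrite !sem_imp; tauto. Qed.

Lemma sem_equal a b w : sem (Equal a b) w <-> eval w a = eval w b.
Proof. simpl; split; [intros [? ?]; lra | intros ->; lra]. Qed.

Lemma sem_all_nonneg t P w :
  sem (AllNonneg t P) w <-> forall r, 0 <= r -> sem P (upd w t r).
Proof.
  unfold AllNonneg; change (sem (All t ?Q) w) with (forall r, sem Q (upd w t r)).
  split; intros H r; specialize (H r); rewrite sem_imp in *; simpl in *;
    rewrite upd_same in *; intros; apply H; lra.
Qed.

Lemma sem_ex_nonneg t P w :
  sem (ExNonneg t P) w <-> exists r, 0 <= r /\ sem P (upd w t r).
Proof.
  simpl; split; intros (r & H & H'); exists r; rewrite upd_same in *; split; auto; lra.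
Qed.

Lemma sem_instance x e P P' : instance x e P P' ->
  forall w, sem P' w <-> sem P (upd w x (eval w e)).
Proof.
  intros [[-> ->] | H] w.
  - simpl; rewrite upd_id; reflexivity.
  - apply (proj1 (substitution x e)) in H; rewrite H; reflexivity.
Qed.

Lemma tautology_valid P : tautology P -> valid P.
Proof.
  intros H w.
  set (v := fun Q => if excluded_middle_informative (sem Q w) then true else false).
  assert (Hv : forall Q, peval v Q = true <-> sem Q w).
  { intros Q; induction Q as [a b|Q IH|Q1 IH1 Q2 IH2|y Q IH|y Q IH|a Q1 IH1 Q2 IH2|a Q1 IH1 Q2 IH2];
      cbn [peval]; try (unfold v; destruct (excluded_middle_informative _); intuition discriminate).
    - rewrite negb_true_iff, <- not_true_iff_false, IH; reflexivity.
    - rewrite andb_true_iff, IH1, IH2; reflexivity. }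
  apply Hv, H.
Qed.

Lemma solution_flow x f t y w r : solution x f t y -> 0 <= r ->
  exists phi, flow x f (sem Top) r phi /\ phi 0 = w /\
              phi r = upd w x (eval (upd w t r) y).
Proof.
  intros Hy Hr; destruct (Hy w) as [H0 H].
  exists (fun s => upd w x (eval (upd w t s) y)); split; [|split; [|reflexivity]].
  - apply (flow_transport _ _ _ _ _ _ _ _ (H r Hr)); intros s Hs.
    split; [reflexivity|]; split; [reflexivity|]; split; [intros _; simpl; lra|].
    intros z Hz; rewrite !upd_other by exact Hz; reflexivity.
  - rewrite H0; apply upd_id.
Qed.

Lemma flow_solution x f t y r phi : solution x f t y -> flow x f (sem Top) r phi ->
  phi r = upd (phi 0) x (eval (upd (phi 0) t r) y).
Proof.
  intros Hy H.
  destruct (solution_flow x f t y (phi 0) r Hy (proj1 H)) as (psi & H' & H0 & <-).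
  eapply flow_unique; [exact H | exact H' | congruence].
Qed.

Lemma fresh_time_irrelevant x t y w r X : t <> x -> insens t X ->
  (X (upd (upd w t r) x (eval (upd w t r) y)) <-> X (upd w x (eval (upd w t r) y))).
Proof.
  intros Htx HX; apply insens_iff with t; [exact HX|].
  apply agree_upd, agree_sym, upd_agree.
Qed.

Lemma dia_ode_valid x f t y P Q : fresh t x f P Q -> solution x f t y ->
  valid (Iff (Dia (ODE x f Top) P Q) (ExNonneg t (Dia (Assign x y) P Q))).
Proof.
  intros (Htx & _ & HP & _) Hy w; apply free_insens in HP.
  rewrite sem_iff, sem_ex_nonneg; cbn [sem angel]; split.
  - intros (r & phi & H & <- & Hr); exists r; split; [apply H|].
    apply fresh_time_irrelevant; [assumption..|].
    rewrite <- (flow_solution x f t y r phi Hy H); exact Hr.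
  - intros (r & Hr & H); apply fresh_time_irrelevant in H; [|assumption..].
    destruct (solution_flow x f t y w r Hy Hr) as (phi & Hphi & H0 & Hr').
    exists r, phi; rewrite Hr'; auto.
Qed.

Lemma box_ode_valid x f t y P Q : fresh t x f P Q -> solution x f t y ->
  valid (Iff (Box (ODE x f Top) P Q)
             (Or (AllNonneg t (Box (Assign x y) P Q))
                 (ExNonneg t (Dia (Assign x y) (And P Q) Q)))).
Proof.
  intros (Htx & _ & HP & HQ) Hy w; apply free_insens in HP, HQ.
  rewrite sem_iff, sem_or, sem_all_nonneg, sem_ex_nonneg; cbn [sem angel demon]; split.
  - intros [H|(r & phi & H & <- & Hr & Hr2)]; [left | right].
    + intros r Hr; apply fresh_time_irrelevant; [assumption..|].
      destruct (solution_flow x f t y w r Hy Hr) as (phi & Hphi & H0 & <-).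
      apply H; assumption.
    + exists r; split; [apply H|].
      rewrite !fresh_time_irrelevant by assumption.
      rewrite <- (flow_solution x f t y r phi Hy H); auto.
  - intros [H|(r & Hr & H)]; [left | right].
    + intros r phi Hphi <-; rewrite (flow_solution x f t y r phi Hy Hphi).
      apply fresh_time_irrelevant with (t := t); [assumption..|]; apply H, Hphi.
    + rewrite !fresh_time_irrelevant in H by assumption.
      destruct (solution_flow x f t y w r Hy Hr) as (phi & Hphi & H0 & Hr').
      exists r, phi; rewrite Hr'; tauto.
Qed.

Lemma fixpoint_rule_valid a P Q R1 R2 :
  valid (Imp (Or P (Dia1 a R1)) R1) ->
  valid (Imp (Or (And P Q) (And (Dia a R2 R2) (Box a R2 R2))) R2) ->
  valid (Imp (Dia (Star a) P Q) (Or R1 R2)).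
Proof.
  intros H1 H2 w; rewrite sem_imp, sem_or; intros [H|H]; [left | right];
    apply H; intros v Hv; [specialize (H1 v); rewrite sem_imp, sem_or in H1
                          | specialize (H2 v); rewrite sem_imp, sem_or in H2]; auto.
Qed.

Lemma determinacy_valid a P : valid (Iff (Not (Dia1 a P)) (Box1 a (Not P))).
Proof.
  intros w; rewrite sem_iff.
  change (~ angel a (sem P) (compl (sem P)) w <->
          demon a (compl (compl (sem P))) (compl (sem P)) w).
  replace (compl (compl (sem P))) with (sem P)
    by (apply sset_ext; intros v; unfold compl; split; [tauto | apply NNPP]).
  split; [apply demon_of_not_angel|].
  intros Hd Hs; apply (game_disjoint a _ _ (disjoint_compl (sem P)) w Hs Hd).
Qed.

Theorem theorem1 (P : fml) : derivable P -> valid P.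
Proof.
  intros H; induction H as
    [P H|P Q _ IH1 _ IH2|x P _ IH|x e P P' H|x P Q|x P H|x P|e|x e1 e2 P P1 P2 H1 H2
    |x e P Q P' H|x e P Q Q' H|x f t y P Q Hf Hy|x f t y P Q Hf Hy|R P Q|R P Q
    |a b P Q|a b P Q|a b P Q|a b P Q|a P Q|a P Q|a P Q
    |a P Q R1 R2 _ IH1 _ IH2|a P1 P2 Q1 Q2 _ IH1 _ IH2|a P1 P2 Q1 Q2 _ IH1 _ IH2|a P].
  - apply tautology_valid, H.
  - intros w; specialize (IH1 w); rewrite sem_imp in IH1; apply IH1, IH2.
  - intros w r; apply IH.
  - intros w; rewrite sem_imp, (sem_instance x e P P' H w); intros Hw; apply Hw.
  - intros w; rewrite !sem_imp; intros H1 H2 r.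
    specialize (H1 r); rewrite sem_imp in H1; apply H1, H2.
  - intros w; rewrite sem_imp; intros Hw r.
    apply (free_insens x P H w); [apply upd_agree | exact Hw].
  - intros w; rewrite sem_iff; simpl; split.
    + intros [r Hr] Hw; apply (Hw r), Hr.
    + intros Hw; apply NNPP; intros Hn; apply Hw; intros r Hr; apply Hn; eauto.
  - intros w; apply sem_equal; reflexivity.
  - intros w; rewrite !sem_imp, sem_equal, (sem_instance x e1 P P1 H1 w),
      (sem_instance x e2 P P2 H2 w); intros ->; auto.
  - intros w; rewrite sem_iff, (sem_instance x e P P' H w); reflexivity.
  - intros w; rewrite sem_iff, (sem_instance x e Q Q' H w); reflexivity.
  - apply dia_ode_valid; assumption.
  - apply box_ode_valid; assumption.
  - intros w; rewrite sem_iff; reflexivity.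
  - intros w; rewrite sem_iff, sem_or; reflexivity.
  - intros w; rewrite sem_iff, sem_or; reflexivity.
  - intros w; rewrite sem_iff, !sem_or; cbn [sem demon angel]; tauto.
  - intros w; rewrite sem_iff; reflexivity.
  - intros w; rewrite sem_iff; reflexivity.
  - intros w; rewrite sem_iff; reflexivity.
  - intros w; rewrite sem_iff, sem_or; apply angel_star_iff.
  - intros w; rewrite sem_iff, !sem_or, or_assoc; apply demon_star_iff.
  - apply fixpoint_rule_valid; assumption.
  - intros w; rewrite sem_imp; apply (angel_mono a); intros v.
    + specialize (IH1 v); rewrite sem_imp in IH1; exact IH1.
    + specialize (IH2 v); rewrite sem_imp in IH2; exact IH2.
  - intros w; rewrite sem_imp; apply (angel_zero_sum_mono a).
    + intros v H1 H2; specialize (IH2 v); rewrite sem_imp in IH2.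
      apply IH2; [split; assumption | simpl; lra].
    + intros v; specialize (IH1 v); rewrite sem_imp in IH1; exact IH1.
  - apply determinacy_valid.
Qed.
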